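(* Let $G$ be a connected $d$-regular graph of order $n$, where $d\ge3$. Then $$t_{\mathrm{hit}}(G)\le\min\left\{\frac{d(n-1)(n+d)}{2(d-1)},\ dn\left(\frac{n}{d-1}-1\right)\right\}\le\frac34(n-1)(n+3),$$ $$\tau^*(G)\le dn\left(\frac{n}{d-1}-1\right)\le\frac32n^2-3n.$$ The bounds independent of $d$, namely $t_{\mathrm{hit}}(G)\le\frac34(n-1)(n+3)$ and $\tau^*(G)\le\frac32n^2-3n$, also hold when $d=2$ and $n\ge3$. As $n$ tends to infinity through even integers, the maxima over all connected regular graphs $G$ of order $n$ satisfy $$\max_Gt_{\mathrm{hit}}(G)=\frac34n^2+O(n),\qquad\max_G\tau^*(G)=\frac32n^2+O(n).$$
   Context: All graphs are finite, simple and undirected. For vertices $s,t$ of a connected graph $G$, $T_t$ is the first time simple random walk on $G$ visits $t$, and $\mathbb E_s$ is expectation for the walk started at $s$. $t_{\mathrm{hit}}(G)=\max_{s,t}\mathbb E_sT_t$ and $\tau^*(G)=\max_{s,t}(\mathbb E_sT_t+\mathbb E_tT_s)$. *)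

(* Defs.v *)
From HB Require Import structures.
From mathcomp Require Import all_boot all_order all_algebra.
From mathcomp Require Import all_classical all_reals all_analysis.

Set Implicit Arguments.
Unset Strict Implicit.
Unset Printing Implicit Defensive.

Import Order.TTheory GRing.Theory Num.Theory.

Local Open Scope ring_scope.

(* A finite simple undirected graph on V, given by its set of edges, each of
   which is an unordered pair of distinct vertices. *)
Record sgraph (V : finType) := SGraph {
  edges :> {set {set V}};
  edges_card2 : [forall A in edges, #|A| == 2] }.

HB.instance Definition _ (V : finType) := [isSub for @edges V].
HB.instance Definition _ (V : finType) := [Finite of sgraph V by <:].

Definition adj (V : finType) (G : sgraph V) : rel V :=
  fun x y => [set x; y] \in edges G.

Definition degree (V : finType) (G : sgraph V) (x : V) : nat :=
  #|[set y | adj G x y]|.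

Definition d_regular (V : finType) (d : nat) (G : sgraph V) : bool :=
  [forall x, degree G x == d].

Definition regular_graph (V : finType) (G : sgraph V) : bool :=
  [forall x, forall y, degree G x == degree G y].

(* The graph with no vertices is not connected. *)
Definition connected_graph (V : finType) (G : sgraph V) : bool :=
  (0 < #|V|)%N && [forall x, forall y, connect (adj G) x y].

Definition rw_step (R : realType) (V : finType) (G : sgraph V) (x y : V) : R :=
  if adj G x y then (degree G x)%:R^-1 else 0.

(* Probability that simple random walk started at s satisfies
   X_1 = w_0, ..., X_k = w_(k-1), where k = size w. *)
Definition rw_prob (R : realType) (V : finType) (G : sgraph V) (s : V)
    (w : seq V) : R :=
  \prod_(i < size w) rw_step R G (nth s (s :: w) i) (nth s (s :: w) i.+1).

(* P_s (T_t = k), where T_t = min {j >= 0 | X_j = t}: for a trajectory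
   s :: w = (X_0, ..., X_k), [index t (s :: w)] is the least j <= k with
   X_j = t, and is k.+1 if there is none. *)
Definition hit_prob (R : realType) (V : finType) (G : sgraph V) (s t : V)
    (k : nat) : R :=
  \sum_(w : k.-tuple V | index t (s :: w) == k) rw_prob R G s w.

(* E_s T_t; the second summand is the contribution of the event T_t = +oo
   (by the convention +oo * 0 = 0 it vanishes when this event is null). *)
Definition hit_exp (R : realType) (V : finType) (G : sgraph V) (s t : V) :
    \bar R :=
  (\sum_(0 <= k <oo) (k%:R * hit_prob R G s t k)%:E
   + +oo * (1 - \sum_(0 <= k <oo) (hit_prob R G s t k)%:E))%E.

Definition t_hit (R : realType) (V : finType) (G : sgraph V) : \bar R :=
  \big[maxe/-oo%E]_(s : V) \big[maxe/-oo%E]_(t : V) hit_exp R G s t.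

Definition tau_star (R : realType) (V : finType) (G : sgraph V) : \bar R :=
  \big[maxe/-oo%E]_(s : V) \big[maxe/-oo%E]_(t : V)
    (hit_exp R G s t + hit_exp R G t s)%E.

(* Every graph of order n is isomorphic to one on 'I_n. *)
Definition max_t_hit (R : realType) (n : nat) : \bar R :=
  \big[maxe/-oo%E]_(G : sgraph 'I_n | connected_graph G && regular_graph G)
    t_hit R G.

Definition max_tau_star (R : realType) (n : nat) : \bar R :=
  \big[maxe/-oo%E]_(G : sgraph 'I_n | connected_graph G && regular_graph G)
    tau_star R G.

(* u n = v n + O(w n) as n tends to infinity through even integers. *)
Definition eq_bigO_even (R : realType) (u : nat -> \bar R) (v w : nat -> R) :
    Prop :=
  exists C : R, \forall n \near \oo%classic,
    ~~ odd n -> (`|u n - (v n)%:E| <= (C * w n)%:E)%E.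

(* Main.v *)
Require Import Defs.
From mathcomp Require Import all_boot all_order all_algebra.
From mathcomp Require Import all_classical all_reals all_analysis.
From mathcomp Require Import zify ring lra.

(**
Write [L u x] for the sum over the neighbours [y] of [x] of [u x - u y]. The
expected hitting time [h_t] of [t] solves [L h_t = d] off [t] and [h_t t = 0],
so [u = h_t - h_s] satisfies [L u = n d (1_s - 1_t)].

Upper bounds. For any function [u], list the vertices by increasing [u] as
[0, ..., n - 1]. Let [P] be a monotone function of the rank such that at every
level [l] the edges [i < l <= j] have total gain [P j - P i] at least [d - 1].
Then summation by parts over the levels gives [(d - 1) (max u - min u) <= sum_x L u x * P x].
Such a [P] with values in an interval of length [n - d + 1] and [P i <= i] is
obtained by bending the rank function: at every cut with few edges (fewer than
[d / 2]) a jump is made by lowering [P] before the cut and raising it after the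
cut. Two such cuts are more than [d] vertices apart, so there is room. At the
remaining levels either at least [d / 2] edges cross, all but one of which gain
two, or a single vertex of the flattened part already has enough neighbours
beyond it. If [d = 2], all cuts are even and the rank itself gains 3 per level.

Lower bounds. On the cubic necklace of diamonds joined by bridges, an explicit
subsolution of the equation for [h_t], quadratic in the index of the diamond,
bounds the hitting times between the two ends from below in both directions.
*)

Set Implicit Arguments.
Unset Strict Implicit.
Unset Printing Implicit Defensive.

(** * Bending the rank function *)

Section Cuts.
Variables (n d : nat) (e : rel nat).
Hypothesis e_sym : symmetric e.
Hypothesis e_irr : irreflexive e.
Hypothesis e_reg : forall i, i < n -> \sum_(0 <= j < n) e i j = d.

(** Vertices are ranks; the cut [l] separates the ranks below [l] from the others, and every
    crossing edge occurs once, oriented upwards. *)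
Definition cut_sum (F : nat -> nat -> nat) (l : nat) : nat :=
  \sum_(0 <= i < l) \sum_(l <= j < n) e i j * F i j.

Definition cut_size := cut_sum (fun _ _ => 1).

Lemma cut_sizeE l : cut_size l = \sum_(0 <= i < l) \sum_(l <= j < n) e i j.
Proof. by do 2 apply: eq_bigr => ? _; rewrite muln1. Qed.

Lemma cut_sum0 F : cut_sum F 0 = 0.
Proof. by rewrite /cut_sum big_geq. Qed.

Lemma cut_sumn F : cut_sum F n = 0.
Proof. by rewrite /cut_sum big1 // => i _; rewrite big_geq. Qed.

Lemma sum_nat_geq_term (F : nat -> nat) a b i :
  a <= i < b -> F i <= \sum_(a <= j < b) F j.
Proof.
move=> /andP[ai ib]; rewrite (big_cat_nat ai (ltnW ib)) /= (big_ltn ib).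
by rewrite addnCA leq_addr.
Qed.

Lemma sum_nat_sub (F : nat -> nat) a b c :
  b <= c -> \sum_(a <= j < b) F j <= \sum_(a <= j < c) F j.
Proof.
move=> bc; case: (leqP a b) => [ab|/ltnW ba]; last by rewrite big_geq.
by rewrite [X in _ <= X](big_cat_nat (n := b)) //= leq_addr.
Qed.

Lemma sum_bool_le (P : pred nat) a b : \sum_(a <= j < b) P j <= b - a.
Proof.
rewrite -[X in _ <= X]muln1 -sum_nat_const_nat.
by apply: leq_sum => j _; case: (P j).
Qed.

Lemma edges_before p w : p <= w < n -> \sum_(0 <= i < p) e w i <= cut_size p.
Proof.
move=> pw; rewrite cut_sizeE exchange_big /=.
apply: leq_trans (sum_nat_geq_term (fun j => \sum_(0 <= i < p) e i j) pw).
by apply: leq_sum => i _; rewrite e_sym.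
Qed.

Lemma edges_inside p q w : p <= w < q -> \sum_(p <= i < q) e w i <= (q - p).-1.
Proof.
move=> /andP[pw wq]; rewrite (big_cat_nat pw (ltnW wq)) /= (big_ltn wq) e_irr add0n.
have := sum_bool_le (e w) p w; have := sum_bool_le (e w) w.+1 q; lia.
Qed.

Lemma degree_split p q w : w < n -> p <= q <= n ->
  d = \sum_(0 <= i < p) e w i + \sum_(p <= i < q) e w i + \sum_(q <= i < n) e w i.
Proof.
move=> wn /andP[pq qn].
rewrite -(e_reg wn) (big_cat_nat (n := q)) //= (big_cat_nat (n := p)) //=.
Qed.

Definition thin l := (l <= n) && (2 * cut_size l < d).

(** If [m = q - p <= d], each of the [m] vertices between the cuts has at most [m - 1] neighbours
    among them, so at least [m * (d + 1 - m) >= d] edges leave the block. They cross one of two cuts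
    having fewer than [d] edges together. *)
Lemma thin_gap p q : thin p -> thin q -> p < q -> p + d < q.
Proof.
move=> /andP[pn kp] /andP[qn kq] pq; rewrite ltnNge; apply/negP => zd.
have : \sum_(p <= w < q) (d.+1 - (q - p)) <=
  \sum_(p <= w < q) (\sum_(0 <= i < p) e w i + \sum_(q <= i < n) e w i).
  rewrite big_nat_cond [X in _ <= X]big_nat_cond; apply: leq_sum => w /andP[/andP[pw wq] _].
  have wn : w < n by lia.
  have pqn : p <= q <= n by rewrite ltnW.
  have := degree_split wn pqn; have := @edges_inside p q w; rewrite pw wq => /(_ isT); lia.
rewrite big_split /= sum_nat_const_nat.
have h1 : \sum_(p <= w < q) \sum_(0 <= i < p) e w i <= cut_size p.
  rewrite cut_sizeE exchange_big /=; apply: leq_sum => i _.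
  apply: leq_trans (sum_nat_sub _ _ qn).
  by apply: leq_sum => w _; rewrite e_sym.
have h2 : \sum_(p <= w < q) \sum_(q <= i < n) e w i <= cut_size q.
  rewrite cut_sizeE [X in _ <= X](big_cat_nat (n := p)) ?(ltnW pq) //=; exact: leq_addl.
nia.
Qed.

(** Across a thin cut every edge gains [2 * bend l - 4]: this is [4 * (d - 1)] for a single edge,
    and half of it when at least two edges share the task. In the latter case each side is shifted
    by [d - 3], an integer thanks to the fourfold scale. *)
Definition bend l := if cut_size l <= 1 then 2 * d else d.+1.

(* [psi] is a monotone modification of the (fourfold) rank [i |-> 4 * (i + 1)]
   that makes room for a jump of [2 * bend l - 4] at every thin cut [l]. *)
Record bent (psi : nat -> nat) : Prop := Bent {
  bent_mono : forall i j, i <= j < n -> psi i <= psi j;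
  bent_lo : forall p i, thin p -> p <= i < n -> 4 * p + bend p <= psi i;
  bent_hi : forall q i, thin q -> i < q -> psi i + bend q <= 4 * q + 4;
  bent_up : forall i, i < n -> 4 * i.+1 < psi i ->
    exists2 p, thin p & p <= i /\ psi i = 4 * p + bend p;
  bent_down : forall i, i < n -> psi i < 4 * i.+1 ->
    exists2 q, thin q & i < q /\ psi i + bend q = 4 * q + 4 }.

End Cuts.

(** The [i]-th selected index is at least the [i]-th index of the range, so moving the selection to
    the front can only decrease a monotone sum. *)
Lemma sum_select_ge (P : pred nat) (g : nat -> nat) a m :
  {homo g : i j / i <= j} ->
  \sum_(a <= j < a + \sum_(a <= j < a + m) P j) g j <= \sum_(a <= j < a + m) P j * g j.
Proof.
move=> gm; elim: m => [|m IH]; first by rewrite addn0 !(big_geq (leqnn a)) addn0 big_geq.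
rewrite addnS !big_nat_recr ?leq_addr //=.
case: (P (a + m)); last by rewrite mul0n !addn0.
rewrite mul1n addn1 addnS big_nat_recr ?leq_addr //=; apply: leq_add => //.
by apply: gm; have := sum_bool_le P a (a + m); lia.
Qed.

(* The sum of the last four terms, some of which may be truncated to zero. *)
Lemma sum_ramp_ge (al a m : nat) : 4 * a <= al ->
  16 * (a + m) <= \sum_(a <= j < a + m) (4 * j.+1 - al) + 4 * al + 24.
Proof.
move=> aal; set S := fun m => \sum_(a <= j < a + m) (4 * j.+1 - al).
suff: [/\ 4 * (a + m) <= S m + al, 8 * (a + m) <= S m + 2 * al + 4,
    12 * (a + m) <= S m + 3 * al + 12 & 16 * (a + m) <= S m + 4 * al + 24].
  by case.
elim: m => [|m [h1 h2 h3 h4]]; first by split; lia.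
have -> : S m.+1 = S m + (4 * (a + m).+1 - al).
  by rewrite /S addnS big_nat_recr ?leq_addr.
by split; lia.
Qed.

(** Each increment of [m] raises the bound by 8, exactly a capped term; while the new term is below
    the cap, the last two terms suffice. *)
Lemma sum_capped_ramp_ge (al a m : nat) : 4 * a <= al ->
  8 * (a + m) <= \sum_(a <= j < a + m) minn (4 * j.+1 - al) 8 + 2 * al + 4.
Proof.
move=> aal; set S := fun m => \sum_(a <= j < a + m) minn (4 * j.+1 - al) 8.
suff: 4 * (a + m) <= S m + al /\ 8 * (a + m) <= S m + 2 * al + 4 by case.
elim: m => [|m [h1 h2]]; first by split; lia.
have -> : S m.+1 = S m + minn (4 * (a + m).+1 - al) 8.
  by rewrite /S addnS big_nat_recr ?leq_addr.
by split; lia.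
Qed.

(** * Gain of a bent rank function over a cut *)

Section Gain.
Variables (n d : nat) (e : rel nat).
Hypothesis e_sym : symmetric e.
Hypothesis e_irr : irreflexive e.
Hypothesis e_reg : forall i, i < n -> \sum_(0 <= j < n) e i j = d.
Hypothesis d_ge3 : 2 < d.

Lemma thin0 : thin n d e 0.
Proof. by rewrite /thin /cut_size cut_sum0; lia. Qed.

Lemma thinn : thin n d e n.
Proof. by rewrite /thin /cut_size cut_sumn; lia. Qed.

Lemma bend_le l : bend n d e l <= 2 * d.
Proof. by rewrite /bend; case: ifP => _; lia. Qed.

Variable psi : nat -> nat.
Hypothesis psi_bent : bent n d e psi.

(** A vertex with [psi j < 4 * j.+1] is held down by a thin cut [q > j]. As [q > p + d], its value
    is at least [4 * q + 4 - 2 * d >= 4 * p + 2 * d + 8]. *)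
Lemma bent_geq p j : thin n d e p -> p <= j < n ->
  minn (4 * j.+1) (4 * p + 2 * d + 8) <= psi j.
Proof.
move=> tp /andP[pj jn]; case: (leqP (4 * j.+1) (psi j)) => [|h]; first by lia.
have [q tq [jq eq]] := bent_down psi_bent jn h.
have := thin_gap e_sym e_irr e_reg tp tq; have := bend_le q; lia.
Qed.

(** A vertex lifted by the cut [p] is close to it, and few edges lead back over [p], so enough
    neighbours come later. Their gain is bounded below by [g] and is least when they follow [w]
    immediately. *)
Lemma lifted_vertex_gain w p : thin n d e p -> p <= w < n ->
  psi w = 4 * p + bend n d e p -> 4 * w.+1 < psi w ->
  4 * d.-1 <= \sum_(w.+1 <= j < n) e w j * (psi j - psi w).
Proof.
move=> tp /andP[pw wn] psiw lift.
set al := 4 * p + bend n d e p; set c := 2 * d + 8 - bend n d e p.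
pose g j := minn (4 * j.+1 - al) c.
have gm : {homo g : i j / i <= j} by move=> i j ij; rewrite /g; lia.
set E := \sum_(w.+1 <= j < n) e w j.
apply: leq_trans (_ : \sum_(w.+1 <= j < w.+1 + E) g j <= _); last first.
  rewrite {1}/E -{1}(subnKC wn).
  apply: leq_trans (sum_select_ge (e w) w.+1 (n - w.+1) gm) _; rewrite subnKC //.
  rewrite big_nat_cond [X in _ <= X]big_nat_cond; apply: leq_sum => j /andP[/andP[wj jn] _].
  rewrite leq_mul2l; apply/orP; right.
  have pjn : p <= j < n by lia.
  have := bent_geq tp pjn; rewrite psiw /g /c -/al; have := bend_le p; lia.
have pwn : p <= w.+1 <= n by lia.
have pw1 : p <= w < w.+1 by lia.
have pwn' : p <= w < n by lia.
have deg := degree_split e_reg wn pwn.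
have := edges_inside e_irr pw1; have := edges_before e_sym pwn'.
have /andP[_ kp] := tp; move: deg; rewrite -/E => deg inside before.
(* With at most one edge back, at least [d - 1 - (w - p)] neighbours come later, and the cap [c] is
   8. *)
case: (leqP (cut_size n e p) 1) => kp1.
  have bp : bend n d e p = 2 * d by rewrite /bend kp1.
  have /(sum_capped_ramp_ge E) : 4 * w.+1 <= al by lia.
  have -> : \sum_(w.+1 <= j < w.+1 + E) minn (4 * j.+1 - al) 8 =
            \sum_(w.+1 <= j < w.+1 + E) g j.
    by apply: eq_bigr => j _; rewrite /g /c bp; lia.
  lia.
have bp : bend n d e p = d.+1 by rewrite /bend leqNgt kp1.
(* The number of later neighbours guaranteed when fewer than [d / 2] edges cross [p]; for these
   terms the cap [c] has no effect. *)
pose m := (d + 4)./2 + p - w.+1.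
have mE : m <= E by rewrite /m; lia.
have : 4 * w.+1 <= al by lia.
move=> /(sum_ramp_ge m).
have -> : \sum_(w.+1 <= j < w.+1 + m) (4 * j.+1 - al) =
          \sum_(w.+1 <= j < w.+1 + m) g j.
  by apply: eq_big_nat => j; rewrite /g /c /al bp /m; lia.
have := @sum_nat_sub g w.+1 (w.+1 + m) (w.+1 + E).
rewrite leq_add2l => /(_ mE); rewrite /al bp /m; lia.
Qed.

Lemma cut_sum_vertex_le (F : nat -> nat -> nat) w L : w < L ->
  \sum_(L <= j < n) e w j * F w j <= cut_sum n e F L.
Proof. by move=> wL; apply: (sum_nat_geq_term (fun i => \sum_(L <= j < n) e i j * F i j)). Qed.

Lemma gain_lifted L : 0 < L <= n -> 4 * L < psi L.-1 ->
  4 * d.-1 <= cut_sum n e (fun i j => psi j - psi i) L.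
Proof.
case: L => // w /andP[_ wn] /= lift.
have [p tp [pw psiw]] := bent_up psi_bent wn lift.
have pwn : p <= w < n by lia.
apply: leq_trans (lifted_vertex_gain tp pwn psiw lift) _.
exact: (cut_sum_vertex_le (fun i j => psi j - psi i)).
Qed.

(** The edges from [w] to later vertices gain enough. Of these only the edge to [w.+1] misses the
    cut [w.+2]; it is worth at most 3, and an edge of [w.+1] over the cut makes up for it with at
    least 4. *)
Lemma gain_lifted2 w : w.+2 < n -> psi w.+1 <= 4 * w.+2 -> 4 * w.+3 <= psi w.+2 ->
  4 * w.+1 < psi w ->
  4 * d.-1 <= cut_sum n e (fun i j => psi j - psi i) w.+2.
Proof.
move=> wn psi1 psi2 lift; have wn' : w < n by lia.
have [p tp [pw psiw]] := bent_up psi_bent wn' lift.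
have pwn : p <= w < n by lia.
have := lifted_vertex_gain tp pwn psiw lift.
rewrite big_ltn; last by lia.
have l1 : e w w.+1 * (psi w.+1 - psi w) <= 3 by case: (e w w.+1); lia.
rewrite /cut_sum 2?big_nat_recr //=.
set S1 := \sum_(w.+2 <= j < n) _; set S2 := \sum_(w.+2 <= j < n) e w.+1 j * _.
suff : 4 <= S2 by lia.
have pwn1 : p <= w.+2 <= n by lia.
have pw1 : p <= w.+1 < w.+2 by lia.
have pwn' : p <= w.+1 < n by lia.
have wn1 : w.+1 < n by lia.
have deg := degree_split e_reg wn1 pwn1.
have := edges_inside e_irr pw1; have := edges_before e_sym pwn'.
have /andP[_ kp] := tp => before inside.
(* So close to [p], the earlier vertices cannot exhaust the degree of [w.+1]. *)
have : 0 < \sum_(w.+2 <= j < n) e w.+1 j.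
  move: psiw lift; rewrite /bend; case: (leqP (cut_size n e p) 1); lia.
move=> E0; apply: leq_trans (_ : \sum_(w.+2 <= j < n) e w.+1 j * 4 <= _).
  by rewrite -big_distrl /=; lia.
rewrite /S2 big_nat_cond [X in _ <= X]big_nat_cond; apply: leq_sum => j /andP[/andP[wj jn] _].
have ij : w.+2 <= j < n by lia.
by have := bent_mono psi_bent ij; rewrite leq_mul2l; lia.
Qed.

(** Every crossing edge gains at least 8, except that the edge from [L.-1] to [L] may gain only 4;
    [d / 2] edges yield [4 * d - 4]. *)
Lemma gain_unbent L : 0 < L < n -> d <= 2 * cut_size n e L ->
  psi L.-1 <= 4 * L -> 4 * L.+1 <= psi L ->
  (2 <= L -> psi L.-2 <= 4 * L.-1) -> (L.+1 < n -> 4 * L.+2 <= psi L.+1) ->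
  4 * d.-1 <= cut_sum n e (fun i j => psi j - psi i) L.
Proof.
case: L => // w /andP[_ wn] kL /= psi0 psi1 psim psip.
suff : 8 * cut_size n e w.+1 <= cut_sum n e (fun i j => psi j - psi i) w.+1 + 4 by lia.
rewrite cut_sizeE /cut_sum !big_nat_recr //= mulnDr -addnA; apply: leq_add.
  rewrite big_distrr /= big_nat_cond [X in _ <= X]big_nat_cond.
  apply: leq_sum => i /andP[/andP[_ iw] _].
  rewrite big_distrr /= big_nat_cond [X in _ <= X]big_nat_cond.
  apply: leq_sum => j /andP[/andP[wj jn] _].
  have h1 : i <= w.-1 < n by lia.
  have h2 : w.+1 <= j < n by lia.
  have := bent_mono psi_bent h1; have := bent_mono psi_bent h2.
  case: w {wn} psi0 psi1 psim psip iw kL wj h1 h2 => //= w *.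
  by case: (e i j); rewrite ?muln0 // muln1 mul1n; lia.
rewrite big_ltn // [X in _ <= X + _]big_ltn // !mulnDr.
have h0 : 8 * e w w.+1 <= e w w.+1 * (psi w.+1 - psi w) + 4 by case: (e w w.+1); lia.
suff : 8 * \sum_(w.+2 <= i < n) e w i <= \sum_(w.+2 <= j < n) e w j * (psi j - psi w) by lia.
rewrite big_distrr /= big_nat_cond [X in _ <= X]big_nat_cond.
apply: leq_sum => j /andP[/andP[wj jn] _].
have h2 : w.+2 <= j < n by lia.
have := bent_mono psi_bent h2.
by case: (e w j); rewrite ?muln0 // muln1 mul1n; lia.
Qed.

Lemma gain_thin L : 0 < L < n -> thin n d e L -> 0 < cut_size n e L ->
  4 * d.-1 <= cut_sum n e (fun i j => psi j - psi i) L.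
Proof.
move=> /andP[L0 Ln] tL kL.
have : (2 * bend n d e L - 4) * cut_size n e L <= cut_sum n e (fun i j => psi j - psi i) L.
  rewrite cut_sizeE /cut_sum.
  rewrite big_distrr /= big_nat_cond [X in _ <= X]big_nat_cond.
  apply: leq_sum => i /andP[/andP[_ iw] _].
  rewrite big_distrr /= big_nat_cond [X in _ <= X]big_nat_cond.
  apply: leq_sum => j /andP[/andP[wj jn] _].
  have jL : L <= j < n by rewrite wj jn.
  have := bent_hi psi_bent tL iw; have := bent_lo psi_bent tL jL.
  by case: (e i j); rewrite ?muln0 // !muln1 mul1n; lia.
rewrite /bend; case: (leqP (cut_size n e L) 1) => k1; nia.
Qed.

End Gain.

Lemma sum_nat_rev (G : nat -> nat) n a b : a <= b <= n ->
  \sum_(a <= i < b) G (n.-1 - i) = \sum_(n - b <= i < n - a) G i.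
Proof.
move=> /andP[ab bn]; rewrite big_nat_rev /= -{1}(add0n a) big_addn.
rewrite -[in RHS](add0n (n - b)) big_addn.
have -> : n - a - (n - b) = b - a by lia.
by apply: eq_big_nat => i ib; congr G; lia.
Qed.

(** * Reversal of the order, and the gain at every cut *)

Section Mirror.
Variables (n d : nat) (e : rel nat).
Hypothesis e_sym : symmetric e.
Hypothesis e_irr : irreflexive e.
Hypothesis e_reg : forall i, i < n -> \sum_(0 <= j < n) e i j = d.
Hypothesis d_ge3 : 2 < d.
Hypothesis e_conn : forall l, 0 < l < n -> 0 < cut_size n e l.

Definition mirror : rel nat := fun i j => e (n.-1 - i) (n.-1 - j).

Lemma mirror_sym : symmetric mirror.
Proof. by move=> i j; apply: e_sym. Qed.

Lemma mirror_irr : irreflexive mirror.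
Proof. by move=> i; apply: e_irr. Qed.

Lemma mirror_reg i : i < n -> \sum_(0 <= j < n) mirror i j = d.
Proof.
move=> iN; rewrite /mirror (sum_nat_rev (fun j => e (n.-1 - i) j)) ?leqnn //.
by rewrite subnn subn0 e_reg //; lia.
Qed.

Lemma cut_sum_mirror (F : nat -> nat -> nat) l : l <= n ->
  cut_sum n mirror (fun i j => F (n.-1 - j) (n.-1 - i)) l = cut_sum n e F (n - l).
Proof.
move=> ln; rewrite /cut_sum /mirror exchange_big /=.
rewrite (sum_nat_rev (fun j => \sum_(0 <= i < l) e (n.-1 - i) j * F j (n.-1 - i))) ?ln //=.
rewrite subnn; apply: eq_bigr => i _.
rewrite (sum_nat_rev (fun j => e j i * F i j)) // subn0.
by apply: eq_bigr => j _; rewrite e_sym.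
Qed.

Lemma cut_size_mirror l : l <= n -> cut_size n mirror l = cut_size n e (n - l).
Proof. exact: (cut_sum_mirror (fun _ _ => 1)). Qed.

Lemma thin_mirror l : l <= n -> thin n d mirror l = thin n d e (n - l).
Proof. by move=> ln; rewrite /thin cut_size_mirror // ln leq_subr. Qed.

Lemma bend_mirror l : l <= n -> bend n d mirror l = bend n d e (n - l).
Proof. by move=> ln; rewrite /bend cut_size_mirror. Qed.

Variable psi : nat -> nat.
Hypothesis psi_bent : bent n d e psi.

(** Reversal exchanges lifted and lowered vertices, so the lemmas on lifted vertices before a cut
    also treat lowered vertices after it. *)
Definition mirror_fun i := 4 * n + 4 - psi (n.-1 - i).

Lemma bent_le i : i < n -> psi i + 2 * d <= 4 * n + 4.
Proof.
move=> iN; have := bent_hi psi_bent (thinn _ _ d_ge3) iN.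
by rewrite /bend /cut_size cut_sumn.
Qed.

Lemma mirror_bent : bent n d mirror mirror_fun.
Proof.
split.
- move=> i j ij; rewrite /mirror_fun leq_sub2l //.
  by apply: (bent_mono psi_bent); lia.
- move=> p i tp pin; have pn : p <= n by lia.
  have iN : n.-1 - i < n - p by lia.
  rewrite thin_mirror // in tp; have := bent_hi psi_bent tp iN.
  rewrite bend_mirror // /mirror_fun; lia.
- move=> q i tq iq; have /andP[qn _] := tq.
  have iN : n - q <= n.-1 - i < n by lia.
  rewrite thin_mirror // in tq; have := bent_lo psi_bent tq iN.
  have iN' : n.-1 - i < n by lia.
  have := bent_le iN'.
  rewrite bend_mirror // /mirror_fun; lia.
- move=> i iN; rewrite /mirror_fun => h.
  have iN' : n.-1 - i < n by lia.
  have [|q tq [iq eq]] := bent_down psi_bent iN'; first by lia.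
  have /andP[qn _] := tq.
  exists (n - q); first by rewrite thin_mirror ?leq_subr // subKn.
  rewrite bend_mirror ?leq_subr // subKn //; lia.
- move=> i iN; rewrite /mirror_fun => h.
  have iN' : n.-1 - i < n by lia.
  have [|p tp [ip ep]] := bent_up psi_bent iN'; first by lia.
  exists (n - p); first by rewrite thin_mirror ?leq_subr // subKn //; lia.
  have := bent_le iN'; rewrite bend_mirror ?leq_subr // subKn; lia.
Qed.

Lemma cut_sum_mirror_fun l : l <= n ->
  cut_sum n mirror (fun i j => mirror_fun j - mirror_fun i) l =
  cut_sum n e (fun i j => psi j - psi i) (n - l).
Proof.
move=> ln; rewrite -cut_sum_mirror //.
apply: eq_big_nat => i /andP[_ il]; apply: eq_big_nat => j /andP[lj jn].
congr (_ * _); rewrite /mirror_fun.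
have iN : n.-1 - i < n by lia.
have jN : n.-1 - j < n by lia.
have := bent_le iN; have := bent_le jN; lia.
Qed.

(** A thin cut has its jump. Otherwise one of the two vertices before the cut is lifted, or one of
    the two after it is lowered, or [gain_unbent] applies. The nearest vertices are examined first,
    as [gain_lifted2] presupposes. *)
Lemma bent_gain l : 0 < l < n ->
  4 * d.-1 <= cut_sum n e (fun i j => psi j - psi i) l.
Proof.
move=> ln; have /andP[l0 lN] := ln.
case: (boolP (thin n d e l)) => [tl|].
  by apply: gain_thin => //; apply: e_conn.
rewrite /thin negb_and -leqNgt (ltnW lN) /= => kl.
case: (leqP (psi l.-1) (4 * l)) => [up1|h]; last first.
  by apply: (gain_lifted e_sym e_irr e_reg d_ge3 psi_bent) => //; lia.
have msym := mirror_sym; have mirr := mirror_irr; have mreg := mirror_reg.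
have mb := mirror_bent.
have nl0 : n - (n - l) = l by lia.
have nl1 : n.-1 - (n - l).-1 = l by lia.
case: (leqP (4 * l.+1) (psi l)) => [dn1|h]; last first.
  have := gain_lifted msym mirr mreg d_ge3 mb (L := n - l).
  rewrite cut_sum_mirror_fun ?leq_subr // nl0 /mirror_fun nl1; apply; lia.
have [up2|[l2 h]] : (2 <= l -> psi l.-2 <= 4 * l.-1) \/ 2 <= l /\ 4 * l.-1 < psi l.-2.
    by case: (leqP 2 l) => ?; case: (leqP (psi l.-2) (4 * l.-1)) => ?; auto.
  case: (leqP (4 * l.+2) (psi l.+1)) => [dn2|h].
    by apply: gain_unbent.
  case: (leqP n l.+1) => nl.
    by apply: gain_unbent => //; lia.
  have := gain_lifted2 msym mirr mreg d_ge3 mb (w := (n - l).-2).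
  have -> : (n - l).-2.+2 = n - l by lia.
  have -> : (n - l).-2.+1 = (n - l).-1 by lia.
  rewrite cut_sum_mirror_fun ?leq_subr // nl0 /mirror_fun nl1.
  have -> : n.-1 - (n - l).-2 = l.+1 by lia.
  have -> : n.-1 - (n - l) = l.-1 by lia.
  apply; lia.
have := gain_lifted2 e_sym e_irr e_reg d_ge3 psi_bent (w := l.-2).
have -> : l.-2.+2 = l by lia.
have -> : l.-2.+1 = l.-1 by lia.
apply; lia.
Qed.

End Mirror.

(** * Existence of a bent rank function *)

Section BentRank.
Variables (n d : nat) (e : rel nat).
Hypothesis e_sym : symmetric e.
Hypothesis e_irr : irreflexive e.
Hypothesis e_reg : forall i, i < n -> \sum_(0 <= j < n) e i j = d.
Hypothesis d_ge3 : 2 < d.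

Let lower p := 4 * p + bend n d e p.
Let upper q := 4 * (n - q) + bend n d e q.

(** The fourfold rank, clamped between the largest floor set by earlier thin cuts and the least
    ceiling [4 * q + 4 - bend q] set by later ones. Complements to [4 * n + 4] turn this minimum
    into a maximum. *)
Definition bent_rank i :=
  maxn (\max_(p < n.+1 | thin n d e p && (p <= i)) (4 * p + bend n d e p))
    (minn (4 * i.+1) (4 * n + 4 -
      \max_(q < n.+1 | thin n d e q && (i < q)) (4 * (n - q) + bend n d e q))).

(** Since [q > p + d] and bends are at most [2 * d], floors and ceilings never conflict. *)
Lemma thin_lower_upper p q : thin n d e p -> thin n d e q -> p < q ->
  lower p + upper q <= 4 * n + 4.
Proof.
move=> tp tq pq; have := thin_gap e_sym e_irr e_reg tp tq pq.
have := bend_le n e d_ge3 p; have := bend_le n e d_ge3 q.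
by have /andP[qn _] := tq; rewrite /lower /upper; lia.
Qed.

Lemma bent_rank_bent : bent n d e bent_rank.
Proof.
have t0 := thin0 n e d_ge3; have tn := thinn n e d_ge3.
pose lo i := \max_(p < n.+1 | thin n d e p && (p <= i)) lower p.
pose hi i := \max_(q < n.+1 | thin n d e q && (i < q)) upper q.
have lo_ge p i : thin n d e p -> p <= i -> lower p <= lo i.
  move=> tp pi; have /andP[pn _] := tp.
  by apply: (leq_bigmax_cond (Ordinal (pn : p < n.+1))); rewrite tp.
have hi_ge q i : thin n d e q -> i < q -> upper q <= hi i.
  move=> tq qi; have /andP[qn _] := tq.
  by apply: (leq_bigmax_cond (Ordinal (qn : q < n.+1))); rewrite tq.
have lo_ex i : exists2 p, thin n d e p & p <= i /\ lo i = lower p.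
  have h : 0 < #|[pred p : 'I_n.+1 | thin n d e p && (p <= i)]|.
    by apply/card_gt0P; exists ord0; rewrite inE t0.
  have [p /andP[tp pi] ep] := eq_bigmax_cond (fun p : 'I_n.+1 => lower p) h.
  by exists (p : nat) => //; split; rewrite // -ep; apply: eq_bigl.
have hi_ex i : i < n -> exists2 q, thin n d e q & i < q /\ hi i = upper q.
  move=> iN; have h : 0 < #|[pred p : 'I_n.+1 | thin n d e p && (i < p)]|.
    by apply/card_gt0P; exists ord_max; rewrite inE tn.
  have [p /andP[tp pi] ep] := eq_bigmax_cond (fun p : 'I_n.+1 => upper p) h.
  by exists (p : nat) => //; split; rewrite // -ep; apply: eq_bigl.
have rankE i : bent_rank i = maxn (lo i) (minn (4 * i.+1) (4 * n + 4 - hi i)) by [].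
have lo_hi i : i < n -> lo i + hi i <= 4 * n + 4.
  move=> iN; have [p tp [pi ->]] := lo_ex i; have [q tq [qi ->]] := hi_ex i iN.
  by apply: thin_lower_upper => //; apply: leq_ltn_trans qi.
split.
- move=> i j /andP[ij jn]; rewrite !rankE.
  have : lo i <= lo j.
    by have [p tp [pi ->]] := lo_ex i; apply: lo_ge => //; apply: leq_trans ij.
  have : hi j <= hi i.
    have [p tp [pi ->]] := hi_ex j jn; apply: hi_ge => //; exact: leq_ltn_trans pi.
  lia.
- move=> p i tp /andP[pi iN]; rewrite rankE leq_max; apply/orP; left; exact: lo_ge.
- move=> q i tq iq; have /andP[qn _] := tq; have iN : i < n by apply: leq_trans qn.
  have := lo_hi _ iN; have := hi_ge _ _ tq iq; rewrite rankE /upper; lia.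
- move=> i iN; rewrite rankE => h; have [p tp [pi ep]] := lo_ex i.
  by exists p => //; split=> //; move: h; rewrite -/(lower p) -ep; have := lo_hi _ iN; lia.
- move=> i iN; rewrite rankE => h; have [q tq [qi eq]] := hi_ex i iN.
  have /andP[qn _] := tq.
  have := lo_hi _ iN; exists q => //; split=> //; move: eq; rewrite /upper; lia.
Qed.

Hypothesis e_conn : forall l, 0 < l < n -> 0 < cut_size n e l.

(** The cuts [0] and [n] have no edges, hence are thin with bend [2 * d]. They set the floor, which
    is subtracted, and the ceiling. *)
Lemma potential_exists : exists phi : nat -> nat,
  [/\ forall i j, i <= j < n -> phi i <= phi j,
      forall i, i < n -> phi i <= 4 * i,
      forall i, i < n -> phi i + 4 * d <= 4 * n + 4 &
      forall l, 0 < l < n -> 4 * d.-1 <= cut_sum n e (fun i j => phi j - phi i) l].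
Proof.
have rb := bent_rank_bent; pose psi := bent_rank.
have bend0 : bend n d e 0 = 2 * d by rewrite /bend /cut_size cut_sum0.
have psi_ge i : i < n -> 2 * d <= psi i.
  move=> iN; have := bent_lo rb (i := i) (thin0 n e d_ge3).
  by rewrite bend0; apply; lia.
exists (fun i => psi i - 2 * d); split.
- by move=> i j ij; have := bent_mono rb ij; rewrite /psi; lia.
- move=> i iN; case: (leqP (psi i) (4 * i.+1)) => h; first by lia.
  have [p tp [pi ep]] := bent_up rb iN h; rewrite /psi ep.
  by have := bend_le n e d_ge3 p; lia.
- by move=> i iN; have := bent_le d_ge3 rb iN; have := psi_ge _ iN; rewrite /psi; lia.
move=> l ln; apply: leq_trans (bent_gain e_sym e_irr e_reg d_ge3 e_conn rb ln) _.
rewrite /cut_sum big_nat_cond [X in _ <= X]big_nat_cond; apply: leq_sum => i /andP[/andP[_ il] _].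
rewrite big_nat_cond [X in _ <= X]big_nat_cond; apply: leq_sum => j /andP[/andP[_ jl] _].
have /psi_ge : i < n by lia.
by move=> h; apply: leq_mul => //; rewrite -/psi; lia.
Qed.

End BentRank.

(** * The plain rank, for degree two *)

Section Rank.
Variables (n : nat) (e : rel nat).

(* Only the edge between the ranks [l - 1] and [l] can have length one. *)
Lemma rank_gain l : 0 < l < n ->
  2 * cut_size n e l <= (cut_sum n e (fun i j => j - i) l).+1.
Proof.
case: l => // l ln; rewrite cut_sizeE /cut_sum !big_nat_recr //= mulnDr -addnS.
apply: leq_add.
  rewrite big_distrr /= big_nat_cond [X in _ <= X]big_nat_cond.
  apply: leq_sum => i /andP[/andP[_ iw] _].
  rewrite big_distrr /= big_nat_cond [X in _ <= X]big_nat_cond.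
  by apply: leq_sum => j /andP[/andP[wj jn] _]; rewrite mulnC leq_mul2l; lia.
rewrite big_ltn // [X in _ <= X.+1]big_ltn // !mulnDr -addSn.
apply: leq_add; first by case: (e l l.+1); lia.
rewrite big_distrr /= big_nat_cond [X in _ <= X]big_nat_cond.
by apply: leq_sum => j /andP[/andP[wj jn] _]; rewrite mulnC leq_mul2l; lia.
Qed.

End Rank.

Import Order.TTheory GRing.Theory Num.Theory.

Local Open Scope ring_scope.

(** * Energy and level sets *)

Section Laplacian.
Variables (R : realType) (V : finType) (G : sgraph V).

Lemma adj_sym : symmetric (adj G).
Proof. by move=> x y; rewrite /adj finset.setUC. Qed.

Lemma adj_irr : irreflexive (adj G).
Proof.
move=> x; apply/negP => xG.
by have /forall_inP/(_ _ xG) := edges_card2 G; rewrite finset.setUid cards1.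
Qed.

Lemma degreeE x : degree G x = (\sum_y adj G x y)%N.
Proof.
rewrite /degree -sum1_card [LHS]big_mkcond /=.
by apply: eq_bigr => y _; rewrite inE; case: adj.
Qed.

Definition laplacian (u : V -> R) (x : V) : R := \sum_(y | adj G x y) (u x - u y).

Lemma laplacianE u x : laplacian u x = \sum_y (adj G x y)%:R * (u x - u y).
Proof. by rewrite /laplacian big_mkcond; apply: eq_bigr => y _; case: adj; rewrite ?mul1r ?mul0r. Qed.

(** Summation by parts; the factor 1/2 is there because each edge is met from both ends. *)
Lemma laplacian_energy u w : \sum_x laplacian u x * w x =
  2^-1 * \sum_x \sum_y (adj G x y)%:R * ((u y - u x) * (w y - w x)).
Proof.
have h1 : \sum_x laplacian u x * w x =
    \sum_x \sum_y (adj G x y)%:R * ((u x - u y) * w x).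
  by apply: eq_bigr => x _; rewrite laplacianE mulr_suml; apply: eq_bigr => y _; ring.
have h2 : \sum_x laplacian u x * w x =
    \sum_x \sum_y (adj G x y)%:R * ((u y - u x) * w y).
  by rewrite h1 exchange_big; apply: eq_bigr => x _; apply: eq_bigr => y _; rewrite adj_sym.
suff : (\sum_x laplacian u x * w x) *+ 2 =
    \sum_x \sum_y (adj G x y)%:R * ((u y - u x) * (w y - w x)).
  by move=> <-; rewrite mulr2n; field.
rewrite mulr2n {1}h1 h2 -big_split; apply: eq_bigr => x _.
by rewrite -big_split /=; apply: eq_bigr => y _; ring.
Qed.

End Laplacian.

(** * Summation by parts over the levels *)

Section Abel.
Variables (R : realType) (n : nat) (e : rel nat).
Hypothesis e_sym : symmetric e.

(** Each [U j - U i] is a signed sum of increments over the levels between [i] and [j]. After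
    exchanging sums, level [l] collects its crossing pairs in both orders; monotonicity of [W] makes
    the truncated differences exact. *)
Lemma energy_levels (U : nat -> R) (W : nat -> nat) :
  (forall i j, (i <= j < n)%N -> (W i <= W j)%N) ->
  \sum_(0 <= i < n) \sum_(0 <= j < n)
     (e i j)%:R * ((U j - U i) * ((W j)%:R - (W i)%:R)) =
  2 * \sum_(1 <= l < n) (U l - U l.-1) *
        (cut_sum n e (fun i j => W j - W i)%N l)%:R.
Proof.
move=> Wm.
pose D i j : R := (W j)%:R - (W i)%:R.
have UE i : (i < n)%N ->
    U i = U 0%N + \sum_(1 <= l < n) (U l - U l.-1) * (l <= i)%:R.
  move=> iN; rewrite (big_cat_nat (n := i.+1)) //= [X in _ + (_ + X)]big1_seq ?addr0; last first.
    by move=> l /=; rewrite mem_index_iota => /andP[il _]; rewrite leqNgt il mulr0.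
  rewrite (eq_big_nat _ _ (F2 := fun l => U l - U l.-1)); last first.
    by move=> l /andP[_ li]; rewrite -ltnS li mulr1.
  by rewrite big_add1 /= telescope_sumr // addrC subrK.
have step : \sum_(0 <= i < n) \sum_(0 <= j < n) (e i j)%:R * ((U j - U i) * D i j) =
    \sum_(1 <= l < n) (U l - U l.-1) *
      \sum_(0 <= i < n) \sum_(0 <= j < n)
        (e i j)%:R * (((l <= j)%:R - (l <= i)%:R) * D i j).
  under [RHS]eq_bigr do rewrite mulr_sumr.
  rewrite [RHS]exchange_big /=; apply: eq_big_nat => i /andP[_ iN].
  under [RHS]eq_bigr do rewrite mulr_sumr.
  rewrite [RHS]exchange_big /=; apply: eq_big_nat => j /andP[_ jN].
  rewrite (UE i iN) (UE j jN).
  have -> : U 0%N + \sum_(1 <= l < n) (U l - U l.-1) * (l <= j)%:R -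
     (U 0%N + \sum_(1 <= l < n) (U l - U l.-1) * (l <= i)%:R) =
     \sum_(1 <= l < n) (U l - U l.-1) * ((l <= j)%:R - (l <= i)%:R).
    rewrite opprD addrACA subrr add0r -sumrN -big_split /=.
    by apply: eq_bigr => l _; ring.
  by rewrite mulr_suml mulr_sumr; apply: eq_bigr => l _; ring.
rewrite step mulr_sumr; apply: eq_big_nat => l /andP[l0 lN].
rewrite mulrCA; congr (_ * _).
pose C := \sum_(0 <= i < l) \sum_(l <= j < n) (e i j)%:R * D i j.
have CE : (cut_sum n e (fun i j => W j - W i)%N l)%:R = C.
  rewrite /cut_sum natr_sum; apply: eq_big_nat => i /andP[_ il].
  rewrite natr_sum; apply: eq_big_nat => j /andP[lj jN].
  by rewrite natrM natrB ?Wm //; lia.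
rewrite CE (big_cat_nat (n := l)) ?(ltnW lN) //= mulr_natl mulr2n; congr (_ + _).
  apply: eq_big_nat => i /andP[_ il]; rewrite (big_cat_nat (n := l)) ?(ltnW lN) //=.
  rewrite big1_seq ?add0r; last first.
    move=> j /=; rewrite mem_index_iota => /andP[_ jl].
    by rewrite (leqNgt l i) (leqNgt l j) il jl subrr mul0r mulr0.
  by apply: eq_big_nat => j /andP[lj jN]; rewrite lj leqNgt il subr0 mul1r.
rewrite /C [RHS]exchange_big /=; apply: eq_big_nat => i /andP[li iN].
rewrite (big_cat_nat (n := l)) ?(ltnW lN) //= [X in _ + X]big1_seq ?addr0; last first.
  move=> j /=; rewrite mem_index_iota => /andP[lj _].
  by rewrite lj li subrr mul0r mulr0.
apply: eq_big_nat => j /andP[_ jl].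
by rewrite li leqNgt jl e_sym /D; congr (_ * _); rewrite /= mulr0n mulr1n; ring.
Qed.

(** The increments of [U] are nonnegative, so every cut gain may be lowered to [c]; then they
    telescope to the range of [U]. *)
Lemma energy_ge (U : nat -> R) (W : nat -> nat) (c i j : nat) :
  (forall i j, (i <= j < n)%N -> U i <= U j) ->
  (forall i j, (i <= j < n)%N -> (W i <= W j)%N) ->
  (forall l, (0 < l < n)%N -> (c <= cut_sum n e (fun i j => W j - W i) l)%N) ->
  (i < n)%N -> (j < n)%N ->
  c%:R * (U i - U j) <= 2^-1 * \sum_(0 <= i < n) \sum_(0 <= j < n)
     (e i j)%:R * ((U j - U i) * ((W j)%:R - (W i)%:R)).
Proof.
move=> Um Wm cW iN jN; rewrite energy_levels // mulKf ?pnatr_eq0 //.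
have : c%:R * (U n.-1 - U 0%N) <= \sum_(1 <= l < n) (U l - U l.-1) *
        (cut_sum n e (fun i j => W j - W i)%N l)%:R.
  have -> : U n.-1 - U 0%N = \sum_(1 <= l < n) (U l - U l.-1).
    by rewrite big_add1 /= telescope_sumr.
  rewrite mulr_sumr big_nat_cond [leRHS]big_nat_cond.
  apply: ler_sum => l /andP[ln _]; rewrite mulrC ler_wpM2l //.
    by rewrite subr_ge0 Um //; lia.
  by rewrite ler_nat cW.
apply: le_trans; rewrite ler_wpM2l // lerB //; apply: Um; lia.
Qed.

End Abel.

(** * Transfer from ranks to the vertices of a graph *)

Section Sorted.
Variables (R : realType) (V : finType) (G : sgraph V) (d : nat) (u : V -> R) (x0 : V).
Hypothesis G_conn : connected_graph G.
Hypothesis G_reg : d_regular d G.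

Let s := sort (fun x y => u x <= u y) (enum V).
Let f := nth x0 s.
Let rk x := index x s.
Let n := #|V|.

(** The guards exclude ranks from [#|V|] on, where [nth] would return [x0]. *)
Definition sorted_adj : rel nat :=
  fun i j => [&& (i < #|V|)%N, (j < #|V|)%N &
    adj G (nth x0 (sort (fun x y => u x <= u y) (enum V)) i)
          (nth x0 (sort (fun x y => u x <= u y) (enum V)) j)].

Let size_s : size s = n. Proof. by rewrite size_sort -cardE. Qed.
Let uniq_s : uniq s. Proof. by rewrite sort_uniq enum_uniq. Qed.
Let mem_s x : x \in s. Proof. by rewrite mem_sort mem_enum. Qed.

Let rk_lt x : (rk x < n)%N. Proof. by rewrite -size_s index_mem mem_s. Qed.
Let frk x : f (rk x) = x. Proof. exact: nth_index. Qed.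
Let rkf i : (i < n)%N -> rk (f i) = i. Proof. by move=> iN; rewrite /rk index_uniq ?size_s. Qed.

Let f_mono i j : (i <= j < n)%N -> u (f i) <= u (f j).
Proof.
move=> /andP[ij jn]; have lex : total (fun x y => u x <= u y) by move=> x y; exact: le_total.
have tr : transitive (fun x y => u x <= u y) by move=> x y z; exact: le_trans.
have := sort_sorted lex (enum V).
rewrite -/s => /(sorted_leq_nth tr _ x0) h; apply: h => //; rewrite ?inE ?size_s //.
by apply: leq_ltn_trans jn.
Qed.

Let sum_rank (T : nmodType) (F : V -> T) : \sum_x F x = \sum_(0 <= i < n) F (f i).
Proof.
rewrite (perm_big s) /=; first by rewrite (big_nth x0) size_s.
by apply: uniq_perm (index_enum_uniq V) uniq_s _ => x; rewrite mem_s mem_index_enum.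
Qed.

Lemma sorted_adj_sym : symmetric sorted_adj.
Proof. by move=> i j; rewrite /sorted_adj adj_sym andbCA. Qed.

Lemma sorted_adj_irr : irreflexive sorted_adj.
Proof. by move=> i; rewrite /sorted_adj adj_irr !andbF. Qed.

Lemma sorted_adj_reg i : (i < #|V|)%N -> (\sum_(0 <= j < #|V|) sorted_adj i j)%N = d.
Proof.
move=> iN; move/forallP/(_ (f i))/eqP: G_reg => <-; rewrite degreeE sum_rank.
by apply: eq_big_nat => j /andP[_ jN]; rewrite /sorted_adj iN jN.
Qed.

(** An empty cut would make the first [l] vertices closed under adjacency. *)
Lemma sorted_adj_conn l : (0 < l < #|V|)%N -> (0 < cut_size #|V| sorted_adj l)%N.
Proof.
move=> /andP[l0 lN]; rewrite lt0n; apply/eqP; rewrite cut_sizeE => cut0.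
have nadj i j : (i < l)%N -> (l <= j < n)%N -> adj G (f i) (f j) = false.
  move=> il /andP[lj jN]; apply/negbTE/negP => aij.
  have h1 : (sorted_adj i j <= \sum_(l <= j < #|V|) sorted_adj i j)%N.
    by apply: (sum_nat_geq_term (fun j => sorted_adj i j : nat)); rewrite lj.
  have h2 : (\sum_(l <= j < #|V|) sorted_adj i j <= 0)%N.
    rewrite -[X in (_ <= X)%N]cut0; apply: (sum_nat_geq_term (fun i => \sum_(l <= j < #|V|) sorted_adj i j)%N).
    by rewrite il.
  have : sorted_adj i j by rewrite /sorted_adj jN (ltn_trans il lN).
  by move: (leq_trans h1 h2); case: sorted_adj.
have cl : closed_mem (adj G) (mem [pred x | (rk x < l)%N]).
  suff cl' x y : adj G x y -> (rk x < l)%N -> (rk y < l)%N.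
    by move=> x y xy; rewrite !inE; apply/idP/idP; apply: cl' => //; rewrite adj_sym.
  move=> xy xl; rewrite ltnNge; apply/negP => ly.
  by have := nadj _ _ xl (introT andP (conj ly (rk_lt y))); rewrite !frk xy.
have /andP[_ /forallP/(_ (f 0%N))/forallP/(_ (f l))] := G_conn.
by move=> /(closed_connect cl); rewrite !inE !rkf ?l0 ?ltnn // (ltn_trans l0).
Qed.

Lemma sorted_energy_ge (W : nat -> nat) (c : nat) (x y : V) :
  (forall i j, (i <= j < #|V|)%N -> (W i <= W j)%N) ->
  (forall l, (0 < l < #|V|)%N ->
     (c <= cut_sum #|V| sorted_adj (fun i j => W j - W i) l)%N) ->
  c%:R * (u x - u y) <= \sum_z laplacian G u z * (W (rk z))%:R.
Proof.
move=> Wm cW.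
have := energy_ge sorted_adj_sym f_mono Wm cW (rk_lt x) (rk_lt y).
rewrite !frk => /le_trans; apply; rewrite laplacian_energy le_eqVlt; apply/orP; left; apply/eqP.
congr (_ * _); rewrite sum_rank; apply: eq_big_nat => i /andP[_ iN].
rewrite sum_rank; apply: eq_big_nat => j /andP[_ jN].
by rewrite /sorted_adj iN jN !rkf.
Qed.

Lemma sum_rank_fun (F : nat -> R) : \sum_z F (rk z) = \sum_(0 <= i < n) F i.
Proof. by rewrite sum_rank; apply: eq_big_nat => i /andP[_ iN]; rewrite rkf. Qed.

Lemma potential_ge3 : (2 < d)%N -> exists P : V -> R,
  [/\ forall x, 0 <= P x <= #|V|%:R + 1 - d%:R,
      2 * \sum_x P x <= #|V|%:R * (#|V|%:R - 1) &
      forall x y, (d%:R - 1) * (u x - u y) <= \sum_z laplacian G u z * P z].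
Proof.
move=> d3.
have [phi [phim phi4 phin phil]] := potential_exists sorted_adj_sym
  sorted_adj_irr sorted_adj_reg d3 sorted_adj_conn.
(* Division by 4 restores the scale of ranks, so the sum is at most that of the ranks. *)
exists (fun x => (phi (rk x))%:R / 4); split.
- move=> x; rewrite divr_ge0 //= ler_pdivrMr //.
  have := phin _ (rk_lt x); rewrite -(ler_nat R) (natrD _ (phi _)) (natrD _ (4 * _)%N 4) (natrM _ 4 d) (natrM _ 4 #|V|); lra.
- rewrite (sum_rank_fun (fun i => (phi i)%:R / 4)).
  have : \sum_(0 <= i < n) ((phi i)%:R / 4 : R) <= \sum_(0 <= i < n) i%:R.
    rewrite big_nat_cond [leRHS]big_nat_cond; apply: ler_sum => i /andP[/andP[_ iN] _].
    by rewrite ler_pdivrMr // mulrC -natrM ler_nat phi4.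
  suff -> : \sum_(0 <= i < n) (i%:R : R) = n%:R * (n%:R - 1) / 2 by lra.
  elim: (n) => [|m IH]; first by rewrite big_geq // !mul0r.
  by rewrite big_nat_recr //= IH -natr1; field.
- move=> x y; have := sorted_energy_ge x y phim phil.
  have -> : (4 * d.-1)%N%:R = 4 * (d%:R - 1) :> R.
    by rewrite natrM -subn1 natrB //; lia.
  have -> : \sum_z laplacian G u z * ((phi (rk z))%:R / 4) =
     (\sum_z laplacian G u z * (phi (rk z))%:R) / 4.
    by rewrite mulr_suml; apply: eq_bigr => z _; rewrite mulrA.
  by rewrite ler_pdivlMr // => h; rewrite -mulrA [_ * 4]mulrC mulrA [_ * 4]mulrC.
Qed.

(** The first [l] degrees sum to [2 * l] and count inner edges twice, so a cut is even, hence has at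
    least two edges, and [rank_gain] gives 3. *)
Lemma potential_eq2 : d = 2%N -> exists P : V -> R,
  [/\ forall x, 0 <= P x <= #|V|%:R - 1 &
      forall x y, 3 * (u x - u y) <= \sum_z laplacian G u z * P z].
Proof.
move=> d2.
have even_cut l : (l <= #|V|)%N -> ~~ odd (cut_size #|V| sorted_adj l).
  move=> lN.
  have : (\sum_(0 <= i < l) \sum_(0 <= j < #|V|) sorted_adj i j)%N = (d * l)%N.
    rewrite (eq_big_nat _ _ (F2 := fun=> d)); first by rewrite sum_nat_const_nat subn0 mulnC.
    by move=> i /andP[_ il]; apply: sorted_adj_reg; apply: leq_trans lN.
  under eq_bigr do rewrite (big_cat_nat (n := l)) //=.
  rewrite big_split /= -cut_sizeE.
  have : ~~ odd (\sum_(0 <= i < l) \sum_(0 <= j < l) sorted_adj i j)%N.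
    elim: (l) => [|k IH]; first by rewrite big_geq.
    rewrite big_nat_recr //= [X in (_ + X)%N]big_nat_recr //= sorted_adj_irr addn0.
    under eq_bigr do rewrite big_nat_recr //=.
    rewrite big_split /= -addnA oddD (negbTE IH) /=.
    have -> : (\sum_(0 <= i < k) sorted_adj i k = \sum_(0 <= i < k) sorted_adj k i)%N.
      by apply: eq_bigr => i _; rewrite sorted_adj_sym.
    by rewrite addnn odd_double.
  by rewrite d2; lia.
exists (fun x => (rk x)%:R); split.
  move=> x; rewrite ler0n /= lerBrDr natr1 ler_nat; exact: rk_lt.
move=> x y; apply: (@sorted_energy_ge id 3) => [i j /andP[]//|l ln].
have := rank_gain sorted_adj ln; have := sorted_adj_conn ln.
have /even_cut : (l <= #|V|)%N by lia.
by case: (cut_size _ _ l) => [|[|k]] //=; lia.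
Qed.

End Sorted.

(** * Hitting times *)

Section HittingFunction.
Variables (R : realType) (V : finType) (G : sgraph V) (d : nat) (t : V).
Hypothesis G_conn : connected_graph G.
Hypothesis G_reg : d_regular d G.

Lemma card_neighbors x : (\sum_y adj G x y)%N = d.
Proof. by rewrite -degreeE; move/forallP/(_ x)/eqP: G_reg. Qed.

Lemma laplacian_degree (u : V -> R) x :
  laplacian G u x = d%:R * u x - \sum_y (adj G x y)%:R * u y.
Proof.
rewrite laplacianE -(card_neighbors x) natr_sum mulr_suml -sumrB.
by apply: eq_bigr => y _; rewrite mulrBr.
Qed.

(** The energy of [u] vanishes, so [u] is constant along edges, and [G] is connected. *)
Lemma harmonic_eq0 (u : V -> R) :
  u t = 0 -> (forall x, x != t -> laplacian G u x = 0) -> forall x, u x = 0.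
Proof.
move=> ut ux x.
have : \sum_x laplacian G u x * u x = 0.
  by apply: big1 => y _; have [->|/ux ->] := eqVneq y t; rewrite ?ut ?mulr0 ?mul0r.
rewrite laplacian_energy => /eqP; rewrite mulf_eq0 invr_eq0 pnatr_eq0 /=.
have ge0 x' y : 0 <= (adj G x' y)%:R * ((u y - u x') * (u y - u x')).
  by rewrite mulr_ge0 // -expr2 sqr_ge0.
rewrite psumr_eq0 => [/allP h|x' _]; last by apply: sumr_ge0.
have eqadj x' y : adj G x' y -> u x' = u y.
  move=> xy; have /= := h x' (mem_index_enum x').
  rewrite psumr_eq0 => [/allP/(_ y (mem_index_enum y))/=|y' _]; last exact: ge0.
  by rewrite xy mul1r mulf_eq0 orbb subr_eq0 => /eqP.
have cl : closed_mem (adj G) (mem [pred x | u x == 0]) by move=> a b /eqadj ab; rewrite !inE ab.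
have /andP[_ /forallP/(_ t)/forallP/(_ x)] := G_conn.
by move=> /(closed_connect cl); rewrite !inE ut eqxx => /esym/eqP.
Qed.

(** The square system is injective by [harmonic_eq0], hence solvable. [A] acts on row vectors: its
    column for [t] evaluates at [t], the others are Laplacians. *)
Lemma hitting_function_exists : exists h : V -> R,
  h t = 0 /\ forall x, x != t -> laplacian G h x = d%:R.
Proof.
pose u (v : 'rV[R]_#|V|) x := v 0 (enum_rank x).
pose A := \matrix_(i < #|V|, j < #|V|)
  (if enum_val j == t then (i == j)%:R
   else (i == j)%:R * d%:R - (adj G (enum_val j) (enum_val i))%:R) : 'M[R]_#|V|.
have uA v x : u (v *m A) x = if x == t then u v x else laplacian G (u v) x.
  rewrite /u mxE; under eq_bigr do rewrite mxE enum_rankK.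
  case: (x == t).
    rewrite (bigD1 (enum_rank x)) //= eqxx mulr1 big1 ?addr0 // => i /negbTE ->.
    by rewrite mulr0.
  rewrite laplacian_degree; under eq_bigr do rewrite mulrBr.
  rewrite sumrB; congr (_ - _).
    rewrite (bigD1 (enum_rank x)) //= eqxx mul1r mulrC big1 ?addr0 // => i /negbTE ->.
    by rewrite mul0r mulr0.
  rewrite (reindex_onto enum_rank enum_val) /=; last by move=> i _; rewrite enum_valK.
  by apply: eq_big => [y|y _]; rewrite enum_rankK ?eqxx // mulrC.
have Aunit : A \in unitmx.
  rewrite -row_free_unit; apply/inj_row_free => v vA.
  have u0 : forall x, u v x = 0.
    apply: harmonic_eq0 => [|x xt].
      by have := uA v t; rewrite eqxx vA /u mxE => <-.
    by have := uA v x; rewrite (negbTE xt) vA /u mxE => <-.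
  by apply/rowP => i; rewrite mxE; have := u0 (enum_val i); rewrite /u enum_valK.
pose b := \row_(j < #|V|) (if enum_val j == t then 0 else d%:R) : 'rV[R]_#|V|.
have bE x : u b x = if x == t then 0 else d%:R by rewrite /u mxE enum_rankK.
exists (u (b *m invmx A)); split.
  by have := uA (b *m invmx A) t; rewrite mulmxKV // bE eqxx.
by move=> x /negbTE xt; have := uA (b *m invmx A) x; rewrite mulmxKV // bE xt.
Qed.

Variable h : V -> R.
Hypothesis h_t : h t = 0.
Hypothesis h_lap : forall x, x != t -> laplacian G h x = d%:R.

Lemma sum_laplacian (u : V -> R) : \sum_x laplacian G u x = 0.
Proof.
have := laplacian_energy G u (fun=> 1); under eq_bigr do rewrite mulr1; move=> ->.
by rewrite big1 ?mulr0 // => x _; rewrite big1 // => y _; rewrite subrr !mulr0.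
Qed.

(** The Laplacian sums to zero, which fixes its value at [t]. *)
Lemma hitting_laplacian x :
  laplacian G h x = d%:R - (x == t)%:R * (#|V|%:R * d%:R).
Proof.
have [->|xt] := eqVneq x t; last by rewrite h_lap // mul0r subr0.
have := sum_laplacian h; rewrite (bigD1 t) //= (eq_bigr (fun=> d%:R)); last first.
  by move=> y yt; rewrite h_lap.
rewrite sumr_const => /eqP; rewrite addr_eq0 => /eqP ->.
have V0 : (0 < #|V|)%N by apply/card_gt0P; exists t.
rewrite (eq_card (B := predC1 t)) // cardC1 -subn1 -(mulr_natr d%:R) natrB // mul1r; ring.
Qed.

Hypothesis d_gt0 : (0 < d)%N.

(** At a minimum the Laplacian is nonpositive, so the minimum lies at [t]. *)
Lemma min_principle (u : V -> R) : 0 <= u t ->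
  (forall x, x != t -> 0 < laplacian G u x) -> forall x, 0 <= u x.
Proof.
move=> ut lu x.
case: (@arg_minP _ _ _ t xpredT u isT) => y _ ymin.
apply: le_trans (ymin x isT); have [-> //|yt] := eqVneq y t.
have := lu y yt; rewrite ltNge; case/negP.
by rewrite /laplacian sumr_le0 // => z _; rewrite subr_le0 ymin.
Qed.

Lemma hitting_ge0 x : 0 <= h x.
Proof. by apply: min_principle; rewrite ?h_t // => y yt; rewrite h_lap ?ltr0n. Qed.

(** Scaling [h] by [1 + del] makes the Laplacian of the difference strictly positive, as
    [min_principle] demands; [del] is so small that [del * h x <= eps]. *)
Lemma subsolution_le (g : V -> R) : g t <= 0 ->
  (forall x, x != t -> laplacian G g x <= d%:R) -> forall x, g x <= h x.
Proof.
move=> gt lg x; apply/ler_addgt0Pl => eps eps0.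
have hx := hitting_ge0 x; pose del := eps / (1 + h x).
have del0 : 0 < del by rewrite divr_gt0 // ltr_pwDl.
suff : 0 <= (1 + del) * h x - g x.
  have : del * h x <= eps by rewrite /del mulrAC ler_pdivrMr ?ltr_pwDl // ler_pM2l // lerDr.
  lra.
apply: (min_principle (u := fun y => (1 + del) * h y - g y)).
  by rewrite h_t mulr0 sub0r oppr_ge0.
move=> y yt; have := lg y yt; have := h_lap yt; rewrite !laplacian_degree => hy gy.
have -> : \sum_z (adj G y z)%:R * ((1 + del) * h z - g z) =
  (1 + del) * (\sum_z (adj G y z)%:R * h z) - \sum_z (adj G y z)%:R * g z.
  by rewrite mulr_sumr -sumrB; apply: eq_bigr => z _; ring.
have : 0 < del * (d%:R * h y - \sum_z (adj G y z)%:R * h z) by rewrite hy mulr_gt0 ?ltr0n.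
lra.
Qed.

End HittingFunction.

(** * First-step recursion for the law of the hitting time *)

Section WalkLaw.
Variables (R : realType) (V : finType) (G : sgraph V).
Implicit Types s t : V.

Lemma big_tuple_cons (k : nat) (F : k.+1.-tuple V -> R) (P : pred (k.+1.-tuple V)) :
  \sum_(w | P w) F w =
  \sum_y \sum_(w : k.-tuple V | P [tuple of y :: w]) F [tuple of y :: w].
Proof.
rewrite pair_big_dep /=.
rewrite (reindex (fun p : V * k.-tuple V => [tuple of p.1 :: p.2])) /=; last first.
  exists (fun w => (thead w, [tuple of behead w])) => [[y w]|w] _ /=.
    by congr pair; apply: val_inj.
  by rewrite [w in RHS]tuple_eta; apply: val_inj.
by apply: eq_bigl => -[y w].
Qed.

Lemma rw_prob_cons s y (w : seq V) :
  rw_prob R G s (y :: w) = rw_step R G s y * rw_prob R G y w.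
Proof.
rewrite /rw_prob /= big_ord_recl /=; congr (_ * _).
apply: eq_bigr => -[i /= iw] _.
by rewrite (set_nth_default y) ?(set_nth_default y s) //= ltnW.
Qed.

Lemma hit_prob0 s t : hit_prob R G s t 0 = (s == t)%:R.
Proof.
rewrite /hit_prob (eq_bigl (fun=> s == t)) => [|w].
  case: (s == t); last by rewrite big_pred0_eq.
  rewrite (big_pred1 [tuple]) => [|w]; first by rewrite /rw_prob big_ord0.
  by rewrite (tuple0 w) [RHS]eqxx.
by rewrite [w]tuple0 /=; case: (s == t).
Qed.

Lemma hit_probS s t k : hit_prob R G s t k.+1 =
  if s == t then 0 else \sum_y rw_step R G s y * hit_prob R G y t k.
Proof.
rewrite /hit_prob; case: (eqVneq s t) => [->|st].
  by rewrite big_pred0 // => w /=; rewrite eqxx.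
rewrite big_tuple_cons; apply: eq_bigr => y _; rewrite mulr_sumr.
apply: eq_big => [w|w _]; first by rewrite /= (negbTE st) eqSS.
exact: rw_prob_cons.
Qed.

End WalkLaw.

Lemma nneseries_eq (R : realType) (a : nat -> R) (L : R) :
  (forall k, 0 <= a k) ->
  (forall N, \sum_(0 <= k < N) a k <= L) ->
  (forall eps, 0 < eps -> exists N, L <= \sum_(0 <= k < N) a k + eps) ->
  (\sum_(0 <= k <oo) (a k)%:E = L%:E)%E.
Proof.
move=> a0 aL La; have a0' k : (0 <= k)%N -> true -> (0 <= (a k)%:E)%E by rewrite lee_fin.
apply/eqP; rewrite eq_le; apply/andP; split.
  apply: lime_le; first by apply: is_cvg_nneseries => k *; rewrite lee_fin.
  by apply: nearW => N; rewrite sumEFin lee_fin.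
apply/lee_addgt0Pr => eps /La[N LN].
apply: (@le_trans _ _ (\sum_(0 <= k < N) (a k)%:E + eps%:E)%E).
  by rewrite sumEFin -EFinD lee_fin.
by rewrite leeD2r // nneseries_lim_ge // => k *; rewrite lee_fin.
Qed.

(** * The expected hitting time solves the Laplace equation *)

Section HittingTime.
Variables (R : realType) (V : finType) (G : sgraph V) (d : nat) (t : V).
Hypothesis G_reg : d_regular d G.
Hypothesis d_gt0 : (0 < d)%N.
Variable h : V -> R.
Hypothesis h_ge0 : forall x, 0 <= h x.
Hypothesis h_t : h t = 0.
Hypothesis h_lap : forall x, x != t -> laplacian G h x = d%:R.

(* [killed u k s] is the expectation of [u X_k] on the event [k < T_t]. *)
Fixpoint killed (u : V -> R) (k : nat) (s : V) : R :=
  if s == t then 0 else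
  if k is k'.+1 then \sum_y rw_step R G s y * killed u k' y else u s.

Let deg_neq0 : d%:R != 0 :> R. Proof. by rewrite pnatr_eq0 -lt0n. Qed.

Lemma rw_stepE x y : rw_step R G x y = (adj G x y)%:R / d%:R.
Proof.
rewrite /rw_step; move/forallP/(_ x)/eqP: G_reg => ->.
by case: adj; rewrite ?mul1r ?mul0r.
Qed.

Lemma rw_step_ge0 x y : 0 <= rw_step R G x y.
Proof. by rewrite rw_stepE divr_ge0. Qed.

Lemma sum_rw_step x : \sum_y rw_step R G x y = 1.
Proof.
under eq_bigr do rewrite rw_stepE.
by rewrite -mulr_suml -natr_sum (card_neighbors G_reg) divff.
Qed.

Lemma hitting_step x : x != t -> h x = 1 + \sum_y rw_step R G x y * h y.
Proof.
move=> /h_lap; rewrite (laplacian_degree G_reg) => hx.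
under eq_bigr do rewrite rw_stepE mulrAC.
by rewrite -mulr_suml; apply: (mulfI deg_neq0); rewrite mulrDr mulr1 mulrC [X in _ + X]mulrC divfK //; lra.
Qed.

Lemma killed_ge0 (u : V -> R) k s : (forall x, 0 <= u x) -> 0 <= killed u k s.
Proof.
move=> u0; elim: k s => [|k IH] s /=; case: (s == t) => //.
by apply: sumr_ge0 => y _; rewrite mulr_ge0 ?rw_step_ge0.
Qed.

Lemma killed1_le k s : killed (fun=> 1) k.+1 s <= killed (fun=> 1) k s.
Proof.
elim: k s => [|k IH] s.
  rewrite /=; case: (s == t) => //; rewrite -[leRHS](sum_rw_step s).
  by apply: ler_sum => y _; rewrite ler_piMr ?rw_step_ge0 //; case: (y == t).
rewrite [leLHS]/= [leRHS]/=; case: (s == t) => //.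
by apply: ler_sum => y _; rewrite ler_wpM2l ?rw_step_ge0 //; apply: IH.
Qed.

Lemma hit_prob_ge0 k s : 0 <= hit_prob R G s t k.
Proof.
elim: k s => [|k IH] s; first by rewrite hit_prob0.
by rewrite hit_probS; case: (s == t) => //; apply: sumr_ge0 => y _; rewrite mulr_ge0 ?rw_step_ge0.
Qed.

Lemma sum_hit_prob k s :
  \sum_(0 <= j < k.+1) hit_prob R G s t j = 1 - killed (fun=> 1) k s.
Proof.
elim: k s => [|k IH] s.
  by rewrite big_nat1 hit_prob0 /=; case: (s == t); rewrite ?subr0 ?subrr.
rewrite big_nat_recl // hit_prob0 /=; under eq_bigr do rewrite hit_probS.
case: (s == t); first by rewrite big1 // addr0 subr0.
rewrite add0r exchange_big /= -[X in X - _](sum_rw_step s) -sumrB.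
by apply: eq_bigr => y _; rewrite -mulr_sumr IH mulrBr mulr1.
Qed.

(** Iterating [hitting_step] collects one unit for each time before [K] at which [t] is still
    unvisited. *)
Lemma hitting_expand K s :
  h s = \sum_(0 <= k < K) killed (fun=> 1) k s + killed h K s.
Proof.
elim: K s => [|K IH] s.
  by rewrite big_geq // add0r /=; case: eqP => [->|].
have [->|st] := eqVneq s t.
  by rewrite h_t /= eqxx addr0 big1 // => -[|k] _ /=; rewrite eqxx.
rewrite big_nat_recl //= (negbTE st) -addrA hitting_step //; congr (_ + _).
rewrite exchange_big /= -big_split /=.
by apply: eq_bigr => y _; rewrite -mulr_sumr -mulrDr -IH.
Qed.

(** Summation by parts: hitting probabilities are differences of survival probabilities, whose sum
    [hitting_expand] evaluates. *)
Lemma sum_hit_time K s :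
  \sum_(0 <= k < K.+1) k%:R * hit_prob R G s t k =
  h s - killed h K s - K%:R * killed (fun=> 1) K s.
Proof.
rewrite (hitting_expand K s) addrK.
elim: K => [|K IH]; first by rewrite big_nat1 big_geq // !mul0r subrr.
rewrite big_nat_recr //= IH [X in _ = X - _]big_nat_recr //=.
have := sum_hit_prob K.+1 s; rewrite big_nat_recr //= sum_hit_prob.
rewrite -natr1 => e; have -> : hit_prob R G s t K.+1 =
  killed (fun=> 1) K s - killed (fun=> 1) K.+1 s by move: e => /=; lra.
by rewrite /=; ring.
Qed.

(** Survival probabilities decrease and their sums stay below [h s], so they tend to 0: the walk
    hits almost surely, the infinite summand is [+oo * 0], and the remainders in [sum_hit_time]
    vanish. *)
Lemma hit_exp_eq s : hit_exp R G s t = (h s)%:E.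
Proof.
pose M := \sum_x h x.
have hM x : h x <= M by rewrite /M (bigD1 x) //= lerDl sumr_ge0.
have M0 : 0 <= M by apply: sumr_ge0.
have q0 k : 0 <= killed (fun=> 1) k s by apply: killed_ge0.
have r0 k : 0 <= killed h k s by apply: killed_ge0.
have rq k x : killed h k x <= M * killed (fun=> 1) k x.
  elim: k x => [|k IH] x /=; case: (x == t); rewrite ?mulr0 ?mulr1 //.
  rewrite mulr_sumr; apply: ler_sum => y _.
  by rewrite mulrCA ler_wpM2l ?rw_step_ge0.
have qm k j : (k <= j)%N -> killed (fun=> 1) j s <= killed (fun=> 1) k s.
  by move=> /subnKC <-; elim: (j - k)%N => [|i IH]; rewrite ?addn0 // addnS (le_trans (killed1_le _ _)).
have qM k : k.+1%:R * killed (fun=> 1) k s <= M.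
  apply: le_trans (hM s); rewrite (hitting_expand k.+1 s) ler_wpDr //.
  rewrite mulr_natl -[k.+1 in leLHS]subn0 -sumr_const_nat big_nat_cond [leRHS]big_nat_cond.
  by apply: ler_sum => i /andP[/andP[_ ik] _]; apply: qm.
have q_small eps : 0 < eps -> exists k, killed (fun=> 1) k s <= eps.
  move=> eps0; have [k kM] : exists k, M / eps <= k.+1%:R.
    exists (Num.truncn (M / eps)); apply: ltW; exact: truncnS_gt.
  exists k; rewrite -(ler_pM2l (ltr0Sn R k)); apply: le_trans (qM k) _.
  by rewrite -ler_pdivrMr.
have total : (\sum_(0 <= k <oo) (hit_prob R G s t k)%:E = 1%:E)%E.
  apply: nneseries_eq => [k|[|N]|eps /q_small[k ke]]; first exact: hit_prob_ge0.
  - by rewrite big_geq.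
  - by rewrite sum_hit_prob gerBl.
  - by exists k.+1; rewrite sum_hit_prob; lra.
rewrite /hit_exp total subee // mule0 adde0.
apply: nneseries_eq => [k|[|N]|eps eps0].
- by rewrite mulr_ge0 ?hit_prob_ge0.
- by rewrite big_geq.
- by rewrite sum_hit_time -addrA gerDl -opprD oppr_le0 addr_ge0 ?mulr_ge0.
(* At time [k + k] the remainders are at most [M] and [2 * M] times the probability of surviving
   time [k]; the 1 keeps the denominator positive. *)
have e0 : 0 < eps / (3 * M + 1) by rewrite divr_gt0 //; lra.
have [k ke] := q_small _ e0; exists (k + k).+1; rewrite sum_hit_time.
(* [P (T > i)] decreases, so its sum over [k <= i < 2 k] is at least
   [k * P (T > 2 k)]. *)
have tail : k%:R * killed (fun=> 1) (k + k) s <= killed h k s.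
  have := hitting_expand k s; rewrite (hitting_expand (k + k) s).
  rewrite (big_cat_nat (n := k)) ?leq_addr //= => e.
  apply: (@le_trans _ _ (\sum_(k <= i < k + k) killed (fun=> 1) i s)).
    have -> : k%:R * killed (fun=> 1) (k + k) s =
        \sum_(k <= i < k + k) killed (fun=> 1) (k + k) s.
      by rewrite sumr_const_nat addnK mulr_natl.
    rewrite big_nat_cond [leRHS]big_nat_cond.
    by apply: ler_sum => i /andP[/andP[_ ik] _]; apply/qm/ltnW.
  by have := r0 (k + k)%N; lra.
have := rq k s; have := rq (k + k)%N s; have := qm k (k + k)%N (leq_addr _ _) => q2 r2 rk.
have : M * killed (fun=> 1) (k + k) s <= M * killed (fun=> 1) k s by rewrite ler_wpM2l.
have : 3 * M * killed (fun=> 1) k s <= eps.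
  apply: le_trans (_ : (3 * M + 1) * killed (fun=> 1) k s <= _).
    by rewrite ler_wpM2r //; lra.
  by rewrite mulrC -ler_pdivlMr //; lra.
rewrite natrD; lra.
Qed.

End HittingTime.

(** * The necklace *)

Section GraphOfRel.
Variables (V : finType) (e : rel V).
Hypothesis e_sym : symmetric e.
Hypothesis e_irr : irreflexive e.

Lemma rel_edges_card2 : [forall A in
  [set A : {set V} | [exists x, exists y, e x y && (A == [set x; y]%SET)]]%SET, #|A| == 2].
Proof.
apply/forall_inP => A; rewrite inE => /existsP[x /existsP[y /andP[xy /eqP->]]].
have xny : x != y by apply: contraTneq xy => ->; rewrite e_irr.
by rewrite cards2 xny.
Qed.

Definition graph_of_rel : sgraph V := SGraph rel_edges_card2.

Lemma adj_graph_of_rel : adj graph_of_rel =2 e.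
Proof.
move=> x y; rewrite /adj /= inE; apply/existsP/idP => [[a /existsP[b /andP[ab /eqP eqs]]]|xy].
  have xab : x \in [set a; b]%SET by rewrite -eqs !inE eqxx.
  have : a \in [set x; y]%SET by rewrite eqs !inE eqxx.
  have : b \in [set x; y]%SET by rewrite eqs !inE eqxx orbT.
  have anb : a == b = false by apply: contraTF ab => /eqP ->; rewrite e_irr.
  move: xab; rewrite !inE => /orP[]/eqP ->.
    by rewrite [b == a]eq_sym anb /= => /eqP <-.
  by rewrite eqxx anb /= => _ /eqP <-; rewrite e_sym.
by exists x; apply/existsP; exists y; rewrite xy eqxx.
Qed.

End GraphOfRel.

Section Necklace.
(* The path [0, ..., n - 1] with chords. It consists of an end piece of [p]
   vertices, of [q] diamonds [K_4 - e], and of an end piece of 5 vertices; the two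
   values of [p] take care of both even residues of [n] modulo 4. *)
Variables (p q : nat).
Hypothesis p57 : p = 5%N \/ p = 7%N.
Let n := (p + 4 * q + 5)%N.

(** Four vertices with two chords form a diamond, lacking the edge from first to last; path edges
    are the bridges. The right end piece mirrors the left one for [p = 5]. *)
Definition chord (i j : nat) : bool :=
  [|| (i == 0) && ((j == 2) || (j == 4)),
      if p == 5 then (i == 1) && (j == 3)
      else (i == 1) && (j == 5) || (i == 3) && (j == 6),
      [&& p <= i, i < p + 4 * q, j == i + 2 & (i - p) %% 4 < 2],
      (j == p + 4 * q + 4) && ((i == p + 4 * q) || (i == p + 4 * q + 2)) |
      (i == p + 4 * q + 1) && (j == p + 4 * q + 3)]%N.

Definition necklace_rel (i j : nat) : bool :=
  [|| j == i.+1, i == j.+1, chord i j | chord j i].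

Lemma necklace_rel_sym : symmetric necklace_rel.
Proof. by move=> i j; rewrite /necklace_rel orbCA; congr [|| _, _ | _]; rewrite orbC. Qed.

Lemma necklace_rel_irr : irreflexive necklace_rel.
Proof. by move=> i; rewrite /necklace_rel /chord; case: p57 => -> /=; lia. Qed.

Definition necklace : sgraph 'I_n :=
  @graph_of_rel 'I_n (fun i j => necklace_rel i j) (fun i => necklace_rel_irr i).

Lemma adj_necklace (i j : 'I_n) : adj necklace i j = necklace_rel i j.
Proof.
exact: (@adj_graph_of_rel 'I_n (fun i j => necklace_rel i j) (fun i j => necklace_rel_sym i j)).
Qed.

Lemma necklace_connected : connected_graph necklace.
Proof.
apply/andP; split; first by rewrite card_ord; lia.
have n0 : (0 < n)%N by lia.
have csym : connect_sym (adj necklace) by apply: sym_connect_sym; apply: adj_sym.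
suff h (i : 'I_n) : connect (adj necklace) (Ordinal n0) i.
  by apply/forallP => x; apply/forallP => y; apply: connect_trans (h y); rewrite csym.
case: i => i iN; elim: i iN => [|i IH] iN; first by rewrite (bool_irrelevance iN n0).
apply: connect_trans (IH (ltnW iN)) _; apply: connect1.
by rewrite adj_necklace /necklace_rel /= eqxx.
Qed.

(** Listing three neighbours settles degree and Laplacian together, leaving only arithmetic on
    [necklace_rel]. *)
Lemma necklace_neighbors (i : 'I_n) (a b c : nat) : (a < n)%N -> (b < n)%N -> (c < n)%N ->
  uniq [:: a; b; c] ->
  (forall j, (j < n)%N -> necklace_rel i j = [|| j == a, j == b | j == c]) ->
  degree necklace i = 3%N /\ forall (R : realType) (g : nat -> R),
    laplacian necklace (fun x => g (nat_of_ord x)) i = 3 * g i - g a - g b - g c.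
Proof.
move=> an bn cn un h; pose l : seq 'I_n := [:: Ordinal an; Ordinal bn; Ordinal cn].
have ul : uniq l by rewrite -(map_inj_uniq val_inj).
have hl y : adj necklace i y = (y \in l).
  by rewrite adj_necklace h // /l !inE -!val_eqE.
split.
  have <- : #|l| = 3%N by rewrite (card_uniqP ul).
  by apply: eq_card => y; rewrite inE hl.
move=> R g; rewrite /laplacian (eq_bigl (mem l)) // -big_uniq //= !big_cons big_nil /=.
by ring.
Qed.

Let N := necklace_neighbors.

Lemma necklace_left (i : 'I_n) : (i < p)%N -> degree necklace i = 3%N.
Proof.
case: i => i iN /= ip.
have h : forall a b c : nat, (a < n)%N -> (b < n)%N -> (c < n)%N -> uniq [:: a; b; c] ->
   (forall j, necklace_rel i j = [|| j == a, j == b | j == c]) ->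
   degree necklace (Ordinal iN) = 3%N.
  by move=> a b c an bn cn un h; case: (N an bn cn un (i := Ordinal iN)).
(* Hiding the goal behind [Q] removes the graph, whose type depends on [p], before [p] becomes 5 or
   7. *)
move: (degree _ _ = 3%N) h => Q h.
move: ip iN h; rewrite /n /necklace_rel /chord; case: p57 => -> ip iN h.
  case: i ip iN h => [|[|[|[|[|i]]]]] ip iN h.
  - by apply: (h 1 2 4)%N => //= *; lia.
  - by apply: (h 0 2 3)%N => //= *; lia.
  - by apply: (h 0 1 3)%N => //= *; lia.
  - by apply: (h 1 2 4)%N => //= *; lia.
  - by apply: (h 0 3 5)%N => //= *; lia.
  - by [].
case: i ip iN h => [|[|[|[|[|[|[|i]]]]]]] ip iN h.
- by apply: (h 1 2 4)%N => //= *; lia.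
- by apply: (h 0 2 5)%N => //= *; lia.
- by apply: (h 0 1 3)%N => //= *; lia.
- by apply: (h 2 4 6)%N => //= *; lia.
- by apply: (h 0 3 5)%N => //= *; lia.
- by apply: (h 1 4 6)%N => //= *; lia.
- by apply: (h 3 5 7)%N => //= *; lia.
- by [].
Qed.

Lemma necklace_right (i : 'I_n) : (p + 4 * q <= i)%N -> degree necklace i = 3%N.
Proof.
case: i => i iN /= ip.
have h : forall a b c : nat, (a < n)%N -> (b < n)%N -> (c < n)%N -> uniq [:: a; b; c] ->
   (forall j, (j < n)%N -> necklace_rel i j = [|| j == a, j == b | j == c]) ->
   degree necklace (Ordinal iN) = 3%N.
  by move=> a b c an bn cn un h; case: (N an bn cn un (i := Ordinal iN)).
move: (degree _ _ = 3%N) h => Q h.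
have [k k5 ik] : exists2 k, (k < 5)%N & i = (p + 4 * q + k)%N.
  by exists (i - (p + 4 * q))%N; move: iN; rewrite /n; lia.
have un a b c : (a < b)%N -> (b < c)%N -> uniq [:: a; b; c].
  by move=> ab bc; rewrite /= !inE; lia.
pose m := (p + 4 * q)%N.
move: h iN; rewrite /n /necklace_rel /chord ik.
case: k k5 {ip ik} => [|[|[|[|[|]]]]] // _ h iN.
- by apply: (h m.-1 m.+1 m.+4); rewrite /m; [lia|lia|lia|apply: un; lia|move=> j; case: p57 => -> /=; lia].
- by apply: (h m m.+2 m.+3); rewrite /m; [lia|lia|lia|apply: un; lia|move=> j; case: p57 => -> /=; lia].
- by apply: (h m.+1 m.+3 m.+4); rewrite /m; [lia|lia|lia|apply: un; lia|move=> j; case: p57 => -> /=; lia].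
- by apply: (h m.+1 m.+2 m.+4); rewrite /m; [lia|lia|lia|apply: un; lia|move=> j; case: p57 => -> /=; lia].
- by apply: (h m m.+2 m.+3); rewrite /m; [lia|lia|lia|apply: un; lia|move=> j; case: p57 => -> /=; lia].
Qed.

Lemma necklace_middle (i : 'I_n) (k r : nat) (a := (p + 4 * k)%N) :
  (k < q)%N -> (r < 4)%N -> i = (a + r)%N :> nat ->
  degree necklace i = 3%N /\ forall (R : realType) (g : nat -> R),
    laplacian necklace (fun x => g (nat_of_ord x)) i = 3 * g i -
    match r with
    | 0 => g a.-1 + g a.+1 + g a.+2
    | 1 => g a + g a.+2 + g a.+3
    | 2 => g a + g a.+1 + g a.+3
    | _ => g a.+1 + g a.+2 + g a.+4
    end.
Proof.
move=> kq r4 ir.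
have un x y z : (x < y)%N -> (y < z)%N -> uniq [:: x; y; z].
  by move=> xy yz; rewrite /= !inE; lia.
have h x y z : (x < y)%N -> (y < z)%N -> (z < n)%N ->
   (forall j, (j < n)%N -> necklace_rel i j = [|| j == x, j == y | j == z]) ->
   degree necklace i = 3%N /\ forall (R : realType) (g : nat -> R),
    laplacian necklace (fun x => g (nat_of_ord x)) i = 3 * g i - (g x + g y + g z).
  move=> xy yz zn h; case: (N (ltn_trans xy (ltn_trans yz zn)) (ltn_trans yz zn) zn (un _ _ _ xy yz) h).
  by move=> -> e; split=> // R g; rewrite e; ring.
have p5 : (5 <= p)%N by case: p57 => ->.
have ge : (p <= a + r)%N by rewrite /a; lia.
have lt : (a + r < p + 4 * q)%N by rewrite /a; lia.
have e1 j : chord (a + r) j = (r < 2)%N && (j == a + r + 2)%N.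
  have m1 : ((a + r - p) %% 4)%N = r by rewrite /a; lia.
  have ne0 : (a + r == 0)%N = false by lia.
  have tab : (if p == 5 then (a + r == 1) && (j == 3)
      else (a + r == 1) && (j == 5) || (a + r == 3) && (j == 6))%N = false.
    by case: p57 ge => -> /= ge; lia.
  have f0 : (a + r == p + 4 * q)%N = false by lia.
  have f1 : (a + r == p + 4 * q + 1)%N = false by lia.
  have f2 : (a + r == p + 4 * q + 2)%N = false by lia.
  by rewrite /chord m1 ne0 tab f0 f1 f2 ge lt !andbF /= !orbF andbC.
have e2 j : chord j (a + r) = (1 < r)%N && (j == a + r - 2)%N.
  have m2 : [&& p <= j, j < p + 4 * q, a + r == j + 2 & (j - p) %% 4 < 2]%N =
      (1 < r)%N && (j == a + r - 2)%N.
    by rewrite /a; lia.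
  have ne2 : (a + r == 2)%N = false by lia.
  have ne4 : (a + r == 4)%N = false by lia.
  have tab : (if p == 5 then (j == 1) && (a + r == 3)
      else (j == 1) && (a + r == 5) || (j == 3) && (a + r == 6))%N = false.
    by case: p57 ge => -> /= ge; lia.
  have f1 : (a + r == p + 4 * q + 4)%N = false by lia.
  have f2 : (a + r == p + 4 * q + 3)%N = false by lia.
  by rewrite /chord m2 ne2 ne4 tab f1 f2 !andbF /= !orbF.
have a1 : (0 < a)%N by rewrite /a; lia.
have an : (a + 4 < n)%N by rewrite /a /n; lia.
rewrite ir in h *.
case: r r4 {ir ge lt} e1 e2 h => [|[|[|[|]]]] // _ e1 e2 h; rewrite ?addn0 ?addn1 ?addn2 in e1 e2 h *;
  apply: h; try lia; move=> j _; rewrite /necklace_rel e1 e2 /=; lia.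
Qed.

Lemma necklace_cubic : d_regular 3 necklace.
Proof.
apply/forallP => i; apply/eqP.
case: (ltnP i p) => ip; first exact: necklace_left.
case: (leqP (p + 4 * q) i) => iq; first exact: necklace_right.
have [] // := @necklace_middle i ((i - p) %/ 4) ((i - p) %% 4); lia.
Qed.

End Necklace.

(** * Subsolutions on the necklace *)

Section NecklaceHitting.
Variables (R : realType) (p q : nat).
Hypothesis p57 : p = 5%N \/ p = 7%N.
Hypothesis q_gt0 : (0 < q)%N.
Let n := (p + 4 * q + 5)%N.

Lemma hit_exp_ge (t : 'I_n) (g : nat -> R) : g t = 0 ->
  (forall i : 'I_n, i != t -> laplacian (necklace q p57) (fun x => g (nat_of_ord x)) i <= 3) ->
  forall s : 'I_n, ((g s)%:E <= hit_exp R (necklace q p57) s t)%E.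
Proof.
move=> gt gl s.
have conn := necklace_connected q p57; have reg := necklace_cubic q p57.
have [h [ht hl]] := @hitting_function_exists R _ _ 3 t conn reg.
have h0 := hitting_ge0 ht hl isT.
rewrite (hit_exp_eq reg isT h0 ht hl) lee_fin.
apply: (subsolution_le reg ht hl isT (g := fun x => g (nat_of_ord x))) => //.
by rewrite gt.
Qed.

(* Drops of the subsolution over the first [k] diamonds, and inside the [k]-th
   one: every vertex injects 3 units of flow, except those of the end pieces,
   which inject nothing, so the bridge into the [k]-th diamond carries [12 k]. *)
Definition height (k : nat) : R := 12 * k%:R ^+ 2 + 6 * k%:R.

Definition slope (k r : nat) : R :=
  match r with 0 => 0 | 1 | 2 => 6 * k%:R + 3 / 2 | _ => 12 * k%:R + 6 end.

Lemma heightS k : height k.+1 = height k + 24 * k%:R + 18.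
Proof. by rewrite /height -natr1; ring. Qed.

(** Constant on each end piece, so that its Laplacian is 0 there off the target [p + 4 * q]. *)
Definition downhill (i : nat) : R :=
  if (i < p)%N then height q else if (p + 4 * q <= i)%N then 0 else
  height q - height ((i - p) %/ 4) - slope ((i - p) %/ 4) ((i - p) %% 4).

Definition uphill (i : nat) : R :=
  if (i < p)%N then 0 else if (p + 4 * q <= i)%N then height q else
  height q - height (q.-1 - (i - p) %/ 4)
    - slope (q.-1 - (i - p) %/ 4) (3 - (i - p) %% 4).

Lemma downhillE i k r : i = (p + 4 * k + r)%N -> (k < q)%N -> (r < 4)%N ->
  downhill i = height q - height k - slope k r.
Proof.
move=> -> kq r4; rewrite /downhill ifN; last by lia.
rewrite ifN; last by lia.
have -> : ((p + 4 * k + r - p) %/ 4)%N = k by lia.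
by have -> : ((p + 4 * k + r - p) %% 4)%N = r by lia.
Qed.

Lemma uphillE i k r : i = (p + 4 * (q.-1 - k) + (3 - r))%N -> (k < q)%N -> (r < 4)%N ->
  uphill i = height q - height k - slope k r.
Proof.
move=> -> kq r4; rewrite /uphill ifN; last by lia.
rewrite ifN; last by lia.
have -> : ((p + 4 * (q.-1 - k) + (3 - r) - p) %/ 4)%N = (q.-1 - k)%N by lia.
have -> : ((p + 4 * (q.-1 - k) + (3 - r) - p) %% 4)%N = (3 - r)%N by lia.
by rewrite !subKn //; lia.
Qed.

Lemma downhill_left i : (i <= p)%N -> downhill i = height q.
Proof.
rewrite leq_eqVlt => /orP[/eqP ->|ip]; last by rewrite /downhill ip.
rewrite (@downhillE _ 0 0) //; last by lia.
by rewrite /height /=; ring.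
Qed.

Lemma downhill_right i : (p + 4 * q <= i)%N -> downhill i = 0.
Proof. by move=> ip; rewrite /downhill ip ifN //; lia. Qed.

Lemma uphill_left i : (i < p)%N -> uphill i = 0.
Proof. by rewrite /uphill => ->. Qed.

Lemma uphill_right i : (p + 4 * q <= i.+1)%N -> uphill i = height q.
Proof.
rewrite leq_eqVlt => /orP[/eqP e|ip].
  rewrite (@uphillE _ 0 0) //; last by lia.
  by rewrite /height /=; ring.
by rewrite /uphill ifN ?ifT //; lia.
Qed.

Lemma chord_pieces i j : chord p q i j ->
  [/\ (i < j)%N, (i < p)%N = (j < p)%N & (i < p + 4 * q)%N = (j < p + 4 * q)%N].
Proof.
rewrite /chord => /or4P[h|h|h|h].
- by move: h; case: p57 => ->; split; lia.
- by move: h; case: p57 => -> /=; split; lia.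
- by split; lia.
- by split; lia.
Qed.

Lemma necklace_rel_left i j : (i < p)%N -> necklace_rel p q i j ->
  (j <= p)%N && ((i.+1 < p)%N ==> (j < p)%N).
Proof. by move=> ip /or4P[/eqP|/eqP|/chord_pieces[]|/chord_pieces[]]; lia. Qed.

Lemma necklace_rel_right i j : (p + 4 * q <= i)%N -> necklace_rel p q i j ->
  (p + 4 * q <= j.+1)%N && ((p + 4 * q < i)%N ==> (p + 4 * q <= j)%N).
Proof. by move=> ip /or4P[/eqP|/eqP|/chord_pieces[]|/chord_pieces[]]; lia. Qed.

Lemma laplacian_flat (g : nat -> R) (i : 'I_n) :
  (forall j, necklace_rel p q i j -> g j = g i) ->
  laplacian (necklace q p57) (fun x => g (nat_of_ord x)) i <= 3.
Proof.
move=> gi; rewrite /laplacian big1 // => j; rewrite adj_necklace => /gi ->.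
by rewrite subrr.
Qed.

Lemma downhill_laplacian (i : 'I_n) : i != (p + 4 * q)%N :> nat ->
  laplacian (necklace q p57) (fun x => downhill (nat_of_ord x)) i <= 3.
Proof.
move=> it; case: (ltnP i p) => ip.
  apply: laplacian_flat => j /(necklace_rel_left ip)/andP[jp _].
  by rewrite !downhill_left // ltnW.
case: (leqP (p + 4 * q) i) => iq.
  apply: laplacian_flat => j /(necklace_rel_right iq)/andP[_ /implyP jq].
  by rewrite !downhill_right //; apply: jq; rewrite ltn_neqAle eq_sym it.
pose k := ((i - p) %/ 4)%N; pose r := ((i - p) %% 4)%N.
have kq : (k < q)%N by rewrite /k; lia.
have r4 : (r < 4)%N by rewrite /r; lia.
have ir : i = (p + 4 * k + r)%N :> nat by rewrite /k /r; lia.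
have [_ ->] := necklace_middle p57 kq r4 ir.
have b0 : downhill (p + 4 * k) = height q - height k by rewrite (@downhillE _ k 0) ?addn0 // subr0.
have b1 := @downhillE (p + 4 * k).+1 k 1 (esym (addn1 _)) kq isT.
have b2 := @downhillE (p + 4 * k).+2 k 2 (esym (addn2 _)) kq isT.
have b3 := @downhillE (p + 4 * k).+3 k 3 (esym (addn3 _)) kq isT.
have b4 : downhill (p + 4 * k).+4 = height q - height k.+1.
  have [kq'|kq'] : (k.+1 < q)%N \/ k.+1 = q by lia.
    by rewrite (@downhillE _ k.+1 0) ?subr0 //; lia.
  by rewrite downhill_right ?kq' ?subrr //; lia.
(* The bridge into diamond [k] drops by [12 * k]; for [k = 0] it carries no flow. *)
have bm : downhill (p + 4 * k).-1 = height q - height k + 12 * k%:R.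
  case: (posnP k) => k0.
    by rewrite downhill_left ?k0 /height; [ring|lia].
  rewrite (@downhillE _ k.-1 3) //; [|lia|lia].
  by rewrite -{3 4}(prednK k0) heightS -natr1 /slope; ring.
rewrite ir; case: (r) r4 => [|[|[|[|//]]]] _; rewrite ?addn0 ?addn1 ?addn2 ?addn3;
  rewrite ?b0 ?b1 ?b2 ?b3 ?b4 ?bm ?heightS /slope; lra.
Qed.

Lemma uphill_laplacian (i : 'I_n) : i != p.-1 :> nat ->
  laplacian (necklace q p57) (fun x => uphill (nat_of_ord x)) i <= 3.
Proof.
move=> it; case: (ltnP i p) => ip.
  apply: laplacian_flat => j /(necklace_rel_left ip)/andP[_ /implyP jp].
  by rewrite !uphill_left //; apply: jp; lia.
case: (leqP (p + 4 * q) i) => iq.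
  apply: laplacian_flat => j /(necklace_rel_right iq)/andP[jq _].
  by rewrite !uphill_right //; lia.
pose k := (q.-1 - (i - p) %/ 4)%N; pose r := ((i - p) %% 4)%N; pose k' := ((i - p) %/ 4)%N.
have kq : (k < q)%N by rewrite /k; lia.
have kq' : (k' < q)%N by rewrite /k'; lia.
have r4 : (r < 4)%N by rewrite /r; lia.
have ir : i = (p + 4 * k' + r)%N :> nat by rewrite /k' /r; lia.
have [_ ->] := necklace_middle p57 kq' r4 ir.
have kk : (k' + k = q.-1)%N by rewrite /k /k'; lia.
have b0 : uphill (p + 4 * k') = height q - height k - slope k 3 by apply: uphillE => //; lia.
have b1 : uphill (p + 4 * k').+1 = height q - height k - slope k 2 by apply: uphillE => //; lia.
have b2 : uphill (p + 4 * k').+2 = height q - height k - slope k 1 by apply: uphillE => //; lia.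
have b3 : uphill (p + 4 * k').+3 = height q - height k - slope k 0 by apply: uphillE => //; lia.
have bm : uphill (p + 4 * k').-1 = height q - height k.+1.
  have [k0|k0] : k' = 0%N \/ (0 < k')%N by lia.
    have -> : k.+1 = q by lia.
    by rewrite uphill_left ?subrr //; lia.
  by rewrite (@uphillE _ k.+1 0) ?subr0 //; lia.
have b4 : uphill (p + 4 * k').+4 = height q - height k + 12 * k%:R.
  case: (posnP k) => k0.
    by rewrite uphill_right ?k0 /height; [ring|lia].
  rewrite (@uphillE _ k.-1 3) //; [|lia|lia].
  by rewrite -{3 4}(prednK k0) heightS -natr1 /slope; ring.
rewrite ir; case: (r) r4 => [|[|[|[|//]]]] _; rewrite ?addn0 ?addn1 ?addn2 ?addn3;
  rewrite ?b0 ?b1 ?b2 ?b3 ?b4 ?bm ?heightS /slope; lra.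
Qed.

Lemma necklace_hit_exp_ge : exists s t : 'I_n,
  ((height q)%:E <= hit_exp R (necklace q p57) s t)%E /\
  ((height q)%:E <= hit_exp R (necklace q p57) t s)%E.
Proof.
have sn : (p.-1 < n)%N by rewrite /n; lia.
have tn : (p + 4 * q < n)%N by rewrite /n; lia.
have p0 : (p.-1 < p)%N by case: p57 => ->.
exists (Ordinal sn), (Ordinal tn); split.
  rewrite -(@downhill_left p.-1); last exact: ltnW.
  apply: (@hit_exp_ge (Ordinal tn) downhill); first exact: downhill_right.
  exact: downhill_laplacian.
rewrite -(@uphill_right (p + 4 * q)); last by lia.
apply: (@hit_exp_ge (Ordinal sn) uphill); first exact: uphill_left.
exact: uphill_laplacian.
Qed.

End NecklaceHitting.

(** * Bounds for regular graphs *)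

Section UpperBounds.
Variables (R : realType) (V : finType) (G : sgraph V) (d : nat).
Hypothesis G_conn : connected_graph G.
Hypothesis G_reg : d_regular d G.
Hypothesis d_gt0 : (0 < d)%N.

Lemma hit_exp_functions (s t : V) : exists f g : V -> R,
  [/\ hit_exp R G s t = (f s)%:E, hit_exp R G t s = (g t)%:E,
      f t = 0 /\ g s = 0, 0 <= f s /\ 0 <= g t &
      (forall x, laplacian G f x = d%:R - (x == t)%:R * (#|V|%:R * d%:R)) /\
      (forall x, laplacian G g x = d%:R - (x == s)%:R * (#|V|%:R * d%:R))].
Proof.
have [f [ft fl]] := @hitting_function_exists R _ _ _ t G_conn G_reg.
have [g [gs gl]] := @hitting_function_exists R _ _ _ s G_conn G_reg.
have f0 := hitting_ge0 ft fl d_gt0; have g0 := hitting_ge0 gs gl d_gt0.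
exists f, g; split => //.
- by rewrite (hit_exp_eq G_reg d_gt0 f0 ft fl).
- by rewrite (hit_exp_eq G_reg d_gt0 g0 gs gl).
- by split=> x; apply: hitting_laplacian.
Qed.

Lemma sum_pick (P : V -> R) (t : V) (c : R) :
  \sum_z (d%:R - (z == t)%:R * c) * P z = d%:R * (\sum_z P z) - c * P t.
Proof.
under eq_bigr do rewrite mulrBl.
rewrite sumrB -mulr_sumr [X in _ - X](bigD1 t) //= eqxx mul1r [X in _ - (_ + X)]big1 ?addr0 // => z /negbTE ->.
by rewrite !mul0r.
Qed.

Lemma laplacianB (f g : V -> R) x :
  laplacian G (fun y => f y - g y) x = laplacian G f x - laplacian G g x.
Proof. by rewrite /laplacian -sumrB; apply: eq_bigr => y _; ring. Qed.

(** Tested against a potential [P], the Laplacian of [f] gives at most [d] times the sum of [P]. For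
    [f - g] that sum cancels, leaving [n * d * (P s - P t)], bounded through the range of [P]. *)
Lemma hit_exp_bounds (s t : V) : (2 < d)%N -> exists a b : R,
  [/\ hit_exp R G s t = a%:E, hit_exp R G t s = b%:E, 0 <= a /\ 0 <= b,
      (d%:R - 1) * (2 * a) <= d%:R * (#|V|%:R * (#|V|%:R - 1)) &
      (d%:R - 1) * (a + b) <= #|V|%:R * d%:R * (#|V|%:R + 1 - d%:R)].
Proof.
move=> d3; have [f [g [-> -> [ft gs] [f0 g0] [fl gl]]]] := hit_exp_functions s t.
exists (f s), (g t); split => //.
  have [P [P0 Psum Pf]] := potential_ge3 f t G_conn G_reg d3.
  have := Pf s t; rewrite ft subr0; under eq_bigr do rewrite fl.
  rewrite sum_pick => h.
  have Pt : 0 <= #|V|%:R * d%:R * P t by rewrite mulr_ge0 //; have /andP[] := P0 t.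
  have : d%:R * (2 * \sum_x P x) <= d%:R * (#|V|%:R * (#|V|%:R - 1)) by rewrite ler_wpM2l.
  lra.
have [P [P0 _ Pf]] := potential_ge3 (fun x => f x - g x) t G_conn G_reg d3.
have := Pf s t; rewrite ft gs; under eq_bigr do rewrite laplacianB fl gl mulrBl.
rewrite sumrB !sum_pick subr0 sub0r opprK => /le_trans; apply.
have /andP[Ps _] := P0 t; have /andP[_ Pt] := P0 s.
have -> : d%:R * \sum_z P z - #|V|%:R * d%:R * P t -
   (d%:R * \sum_z P z - #|V|%:R * d%:R * P s) = #|V|%:R * d%:R * (P s - P t) by ring.
by rewrite ler_wpM2l //; lra.
Qed.

Lemma hit_exp_bounds2 (s t : V) : d = 2%N -> exists a b : R,
  [/\ hit_exp R G s t = a%:E, hit_exp R G t s = b%:E, 0 <= a /\ 0 <= b &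
      3 * (a + b) <= #|V|%:R * 2 * (#|V|%:R - 1)].
Proof.
move=> d2; have [f [g [-> -> [ft gs] [f0 g0] [fl gl]]]] := hit_exp_functions s t.
exists (f s), (g t); split => //.
have [P [P0 Pf]] := potential_eq2 (fun x => f x - g x) t G_conn G_reg d2.
have := Pf s t; rewrite ft gs; under eq_bigr do rewrite laplacianB fl gl mulrBl.
rewrite sumrB !sum_pick subr0 sub0r opprK => /le_trans; apply.
have /andP[Ps _] := P0 t; have /andP[_ Pt] := P0 s.
have -> : d%:R * \sum_z P z - #|V|%:R * d%:R * P t -
   (d%:R * \sum_z P z - #|V|%:R * d%:R * P s) = #|V|%:R * d%:R * (P s - P t) by ring.
rewrite d2; rewrite ler_wpM2l //; lra.
Qed.

End UpperBounds.

Section Maxima.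
Variables (R : realType) (V : finType) (G : sgraph V) (c : \bar R).

Lemma t_hit_le : (forall s t, (hit_exp R G s t <= c)%E) -> (t_hit R G <= c)%E.
Proof. by move=> h; do 2 (apply: bigmax_le => [|? _]; first exact: leNye). Qed.

Lemma tau_star_le :
  (forall s t, (hit_exp R G s t + hit_exp R G t s <= c)%E) -> (tau_star R G <= c)%E.
Proof. by move=> h; do 2 (apply: bigmax_le => [|? _]; first exact: leNye). Qed.

Lemma t_hit_ge s t : (hit_exp R G s t <= t_hit R G)%E.
Proof. by apply: (bigmax_sup s) => //; apply: (bigmax_sup t). Qed.

Lemma tau_star_ge s t : (hit_exp R G s t + hit_exp R G t s <= tau_star R G)%E.
Proof. by apply: (bigmax_sup s) => //; apply: (bigmax_sup t). Qed.

End Maxima.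

Lemma min_bound_le (R : realType) (d n : R) : 3 <= d -> 1 <= n ->
  Num.min (d * (n - 1) * (n + d) / (2 * (d - 1))) (d * n * (n / (d - 1) - 1)) <=
  3 / 4 * (n - 1) * (n + 3).
Proof.
move=> d3 n1; have d1 : 0 < d - 1 by lra.
(* The gap between the first bound and the target has the factor [(d - 3) * (n - (2 * d - 3))], so
   the second bound takes over for [n < 2 * d - 3]. *)
rewrite ge_min; case: (lerP (2 * d - 3) n) => dn; apply/orP; [left|right].
  rewrite ler_pdivrMr ?mulr_gt0 //.
  have h : 0 <= (n - 1) * ((d - 3) * (n - (2 * d - 3))) by rewrite !mulr_ge0 //; lra.
  nra.
have -> : d * n * (n / (d - 1) - 1) = d * n * (n + 1 - d) / (d - 1) by field; lra.
rewrite ler_pdivrMr //.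
have h1 : 0 <= n * ((d + 3) * (2 * d - 3 - n)) by rewrite !mulr_ge0 //; lra.
have x2 := sqr_ge0 (d - 3).
have h2 : 0 <= (n - 1) * (2 * (d - 3) ^+ 2 + 11 * (d - 3) + 18) by rewrite mulr_ge0 //; lra.
have h3 : 0 <= 2 * (d - 3) ^+ 2 + 2 * (d - 3) by lra.
nra.
Qed.

Lemma commute_bound_le (R : realType) (d n : R) : 3 <= d -> 1 <= n ->
  d * n * (n / (d - 1) - 1) <= 3 / 2 * n ^+ 2 - 3 * n.
Proof.
move=> d3 n1; have d1 : 0 < d - 1 by lra.
have -> : d * n * (n / (d - 1) - 1) = d * n * (n + 1 - d) / (d - 1) by field; lra.
rewrite ler_pdivrMr //.
(* The two sides differ by half of this product. *)
have h : 0 <= n * ((d - 3) * (n + 2 * (d - 1))) by rewrite !mulr_ge0 //; lra.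
nra.
Qed.

Section RegularBounds.
Variables (R : realType) (V : finType) (G : sgraph V).
Hypothesis G_conn : connected_graph G.

Lemma regular_ge3_bounds (d : nat) : d_regular d G -> (3 <= d)%N ->
  let d' : R := d%:R in
  let n' : R := #|V|%:R in
  let B1 := d' * (n' - 1) * (n' + d') / (2 * (d' - 1)) in
  let B2 := d' * n' * (n' / (d' - 1) - 1) in
  [/\ (t_hit R G <= (Num.min B1 B2)%:E)%E,
      Num.min B1 B2 <= 3 / 4 * (n' - 1) * (n' + 3),
      (tau_star R G <= B2%:E)%E
    & B2 <= 3 / 2 * n' ^+ 2 - 3 * n'].
Proof.
move=> G_reg d3 d' n' B1 B2; have d0 : (0 < d)%N by lia.
have d3' : 3 <= d' by rewrite /d' ler_nat.
have n1 : 1 <= n' by rewrite /n' ler1n; case/andP: G_conn.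
have d1 : 0 < d' - 1 by lra.
have B2E : B2 = n' * d' * (n' + 1 - d') / (d' - 1) by rewrite /B2; field; lra.
split; [|exact: min_bound_le| |exact: commute_bound_le].
  apply: t_hit_le => s t.
  have [a [b [-> _ [a0 b0] ha hab]]] := hit_exp_bounds R G_conn G_reg d0 s t d3.
  rewrite lee_fin le_min; apply/andP; split.
    rewrite /B1 ler_pdivlMr ?mulr_gt0 //.
    have : 0 <= d' * (n' - 1) * d' by rewrite !mulr_ge0 //; lra.
    move: ha; rewrite -/d' -/n'; lra.
  rewrite B2E ler_pdivlMr //; apply: le_trans hab.
  by rewrite mulrC ler_wpM2l ?lerDl // ltW.
apply: tau_star_le => s t.
have [a [b [-> -> [a0 b0] ha hab]]] := hit_exp_bounds R G_conn G_reg d0 s t d3.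
by rewrite -EFinD lee_fin B2E ler_pdivlMr // mulrC.
Qed.

Lemma regular2_bounds : d_regular 2 G -> (3 <= #|V|)%N ->
  let n' : R := #|V|%:R in
  (t_hit R G <= (3 / 4 * (n' - 1) * (n' + 3))%:E)%E
  /\ (tau_star R G <= (3 / 2 * n' ^+ 2 - 3 * n')%:E)%E.
Proof.
move=> G_reg n3 n'; have n3' : 3 <= n' by rewrite /n' ler_nat.
have h0 : 0 <= (n' - 3) ^+ 2 by rewrite sqr_ge0.
split.
  apply: t_hit_le => s t.
  have [a [b [-> _ [a0 b0] hab]]] := hit_exp_bounds2 R G_conn G_reg isT s t erefl.
  rewrite lee_fin; move: hab; rewrite -/n'; nra.
apply: tau_star_le => s t.
have [a [b [-> -> [a0 b0] hab]]] := hit_exp_bounds2 R G_conn G_reg isT s t erefl.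
rewrite -EFinD lee_fin; move: hab; rewrite -/n'; nra.
Qed.

(** With degree at most 1, a vertex and its neighbours form a closed set of at most two elements. *)
Lemma connected_degree_ge2 (d : nat) : d_regular d G -> (3 <= #|V|)%N -> (2 <= d)%N.
Proof.
move=> G_reg n3; rewrite leqNgt; apply/negP => d1.
have degE x : #|[set y | adj G x y]%SET| = d by move/forallP/(_ x)/eqP: G_reg.
have inj x y z : adj G x y -> adj G x z -> y = z.
  have : (#|[set y | adj G x y]%SET| <= 1)%N by rewrite degE; lia.
  by move/card_le1_eqP => h xy xz; apply: h; rewrite inE.
have /card_gt0P[x _] : (0 < #|V|)%N by lia.
have cl : closed_mem (adj G) (mem (x |: [set y | adj G x y])%SET).
  suff cl' a b : adj G a b -> a \in (x |: [set y | adj G x y])%SET ->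
      b \in (x |: [set y | adj G x y])%SET.
    by move=> a b ab; apply/idP/idP; apply: cl' => //; rewrite adj_sym.
  rewrite !inE => ab /orP[/eqP ax|xa]; first by rewrite -ax ab orbT.
  by rewrite (inj a b x) ?eqxx // adj_sym.
have all x' : x' \in (x |: [set y | adj G x y])%SET.
  have /andP[_ /forallP/(_ x)/forallP/(_ x')] := G_conn.
  by move=> /(closed_connect cl) <-; rewrite !inE eqxx.
have : (#|V| <= #|(x |: [set y | adj G x y])%SET|)%N.
  by rewrite -cardsT; apply/subset_leq_card/fintype.subsetP => y _; apply: all.
have := cardsU1 x [set y | adj G x y]%SET; rewrite degE; case: (x \notin _); lia.
Qed.

Lemma regular_bounds : regular_graph G -> (3 <= #|V|)%N ->
  let n' : R := #|V|%:R in
  (t_hit R G <= (3 / 4 * (n' - 1) * (n' + 3))%:E)%E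
  /\ (tau_star R G <= (3 / 2 * n' ^+ 2 - 3 * n')%:E)%E.
Proof.
move=> G_reg n3; have /card_gt0P[x _] : (0 < #|V|)%N by lia.
have G_reg' : d_regular (degree G x) G.
  by apply/forallP => y; move/forallP/(_ y)/forallP/(_ x): G_reg.
have := connected_degree_ge2 G_reg' n3.
rewrite leq_eqVlt => /orP[/eqP d2|d3].
  by apply: regular2_bounds => //; rewrite d2.
have [h1 h2 h3 h4] := regular_ge3_bounds G_reg' d3.
by split; [apply: le_trans h1 _ | apply: le_trans h3 _]; rewrite lee_fin.
Qed.

End RegularBounds.

Lemma even_necklace (R : realType) (n : nat) : (14 <= n)%N -> ~~ odd n ->
  exists G : sgraph 'I_n, exists s t : 'I_n,
  [/\ connected_graph G, regular_graph G,
    ((3 / 4 * n%:R ^+ 2 - 18 * n%:R)%:E <= hit_exp R G s t)%E &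
    ((3 / 4 * n%:R ^+ 2 - 18 * n%:R)%:E <= hit_exp R G t s)%E].
Proof.
move=> n14 en.
have [p p57 [q q0 ->]] : exists2 p, p = 5%N \/ p = 7%N &
    exists2 q, (0 < q)%N & n = (p + 4 * q + 5)%N.
  have [n2|n0] : (n %% 4 = 2 \/ n %% 4 = 0)%N by lia.
    by exists 5%N; [left|exists ((n - 10) %/ 4)%N; lia].
  by exists 7%N; [right|exists ((n - 12) %/ 4)%N; lia].
(* Here [4 * q <= n <= 4 * q + 12], and 18 absorbs the linear term [72 * q] of
   [3 / 4 * (4 * q + 12) ^ 2]. *)
have hq : 3 / 4 * (p + 4 * q + 5)%:R ^+ 2 - 18 * (p + 4 * q + 5)%:R <= height R q.
  have : (p + 4 * q + 5)%:R <= 4 * q%:R + 12 :> R.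
    by rewrite -natrM -natrD ler_nat; case: p57 => ->; lia.
  have : 4 * q%:R <= (p + 4 * q + 5)%:R :> R by rewrite -natrM ler_nat; lia.
  have : 0 <= q%:R :> R by [].
  rewrite /height; move: ((p + 4 * q + 5)%:R : R) (q%:R : R) => x y y0 yx xy.
  have : 0 <= (x - 4 * y) * (4 * y + 12 - x) by rewrite mulr_ge0 //; lra.
  nra.
have [s [t [st ts]]] := necklace_hit_exp_ge R p57 q0.
exists (necklace q p57), s, t.
split.
- exact: necklace_connected.
- have cub := necklace_cubic q p57.
  by apply/forallP => x; apply/forallP => y; rewrite !(eqP (forallP cub _)).
- by apply: le_trans st; rewrite lee_fin.
- by apply: le_trans ts; rewrite lee_fin.
Qed.

Lemma abse_sub_le (R : realType) (X : \bar R) (a b v c : R) :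
  (a%:E <= X)%E -> (X <= b%:E)%E -> v - c <= a -> b <= v + c ->
  (`|X - v%:E| <= c%:E)%E.
Proof.
case: X => [x| |] //=; rewrite !lee_fin => ax xb va bv.
by rewrite ler_norml; lra.
Qed.

Theorem theorem6p3 (R : realType) :
  (forall (V : finType) (G : sgraph V) (d n : nat),
    connected_graph G -> d_regular d G -> #|V| = n -> (3 <= d)%N ->
    let d' : R := d%:R in
    let n' : R := n%:R in
    let B1 := d' * (n' - 1) * (n' + d') / (2 * (d' - 1)) in
    let B2 := d' * n' * (n' / (d' - 1) - 1) in
    [/\ (t_hit R G <= (Num.min B1 B2)%:E)%E,
        Num.min B1 B2 <= 3 / 4 * (n' - 1) * (n' + 3),
        (tau_star R G <= B2%:E)%E
      & B2 <= 3 / 2 * n' ^+ 2 - 3 * n'])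
  /\ (forall (V : finType) (G : sgraph V) (n : nat),
    connected_graph G -> d_regular 2 G -> #|V| = n -> (3 <= n)%N ->
    let n' : R := n%:R in
    (t_hit R G <= (3 / 4 * (n' - 1) * (n' + 3))%:E)%E
    /\ (tau_star R G <= (3 / 2 * n' ^+ 2 - 3 * n')%:E)%E)
  /\ eq_bigO_even (max_t_hit R)
       (fun n => 3 / 4 * n%:R ^+ 2) (fun n => n%:R)
  /\ eq_bigO_even (max_tau_star R)
       (fun n => 3 / 2 * n%:R ^+ 2) (fun n => n%:R).
Proof.
split; first by move=> V G d n G_conn G_reg <-; apply: regular_ge3_bounds.
split; first by move=> V G n G_conn G_reg <-; apply: regular2_bounds.
split.
  (* The lower bound loses [18 * n], the upper one only [3 / 2 * n]; the smallest necklace with a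
     diamond has order 14. *)
  exists 18; exists 14%N => // n /= n14 en.
  have [G [s [t [G_conn G_reg st ts]]]] := even_necklace R n14 en.
  apply: (@abse_sub_le _ _ (3 / 4 * n%:R ^+ 2 - 18 * n%:R) (3 / 4 * (n%:R - 1) * (n%:R + 3))).
  - apply: le_trans st _; apply: le_trans (t_hit_ge _ _ _ _) _.
    by apply: (bigmax_sup G); rewrite ?G_conn.
  - apply: bigmax_le => [|H /andP[H_conn H_reg]]; first exact: leNye.
    have [] := regular_bounds R H_conn H_reg; rewrite card_ord //; lia.
  - by [].
  - have : 0 <= n%:R :> R by [].
    move: (n%:R : R) => x x0; nra.
(* One pair of vertices is far apart in both directions, so the lower bounds add up. *)
exists 36; exists 14%N => // n /= n14 en.
have [G [s [t [G_conn G_reg st ts]]]] := even_necklace R n14 en.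
apply: (@abse_sub_le _ _ (2 * (3 / 4 * n%:R ^+ 2 - 18 * n%:R)) (3 / 2 * n%:R ^+ 2 - 3 * n%:R)).
- apply: le_trans (_ : (hit_exp R G s t + hit_exp R G t s <= _)%E).
    by rewrite mulr_natl mulr2n EFinD leeD.
  apply: le_trans (tau_star_ge _ _ _ _) _.
  by apply: (bigmax_sup G); rewrite ?G_conn.
- apply: bigmax_le => [|H /andP[H_conn H_reg]]; first exact: leNye.
  have [] := regular_bounds R H_conn H_reg; rewrite card_ord //; lia.
- lra.
- have : 0 <= n%:R :> R by [].
  move: (n%:R : R) => x x0; lra.
Qed.
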